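(* Let $\Bbbk$ be a field of characteristic $0$, and let $K$ be the $8$-vertex simplicial complex on $[8]=\{1,\dots,8\}$ with Stanley-Reisner ideal $$I_K=(x_1x_2,\ x_1x_3x_4x_5,\ x_3x_4x_5x_6,\ x_3x_5x_6x_7,\ x_7x_8).$$ There is an indecomposable Massey product $\langle\alpha,\beta,\gamma\rangle$ in $H^{12}(\mathcal{Z}_K,\Bbbk)$, with $\alpha,\gamma\in H^3(\mathcal{Z}_K,\Bbbk)$ and $\beta\in H^7(\mathcal{Z}_K,\Bbbk)$.
   Context: The Stanley-Reisner ideal $I_K\subset\Bbbk[x_1,\dots,x_n]$ of a simplicial complex $K$ on $[n]$ is generated by the monomials $\prod_{i\in\sigma}x_i$ for $\sigma\notin K$; so a subset $\sigma\subseteq[8]$ is a simplex of the present $K$ iff $\prod_{i\in\sigma}x_i\notin I_K$. For a simplicial complex $K$ on vertex set $[n]$, the moment-angle complex is $\mathcal{Z}_K=\bigcup_{\sigma\in K}\{z\in (D^2)^{\times n}: |z_i|=1 \text{ for } i\notin\sigma\}$, where $D^2\subset\mathbb{C}$ is the closed unit disk. Massey products in $H^*(\mathcal{Z}_K,\Bbbk)$ are computed from the cellular cochain algebra $C^*_{\mathrm{cw}}(\mathcal{Z}_K,\Bbbk)=\big((S/I_K)\otimes_\Bbbk E\big)/(x_i^2,\ x_iu_i)$, a commutative differential graded algebra whose cohomology is $H^*(\mathcal{Z}_K,\Bbbk)$ (it is quasi-isomorphic to the Koszul complex $S/I_K\otimes_\Bbbk E$). Here $S=\Bbbk[x_1,\dots,x_n]$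 with $\deg x_i=2$, $E$ is the exterior algebra on $u_1,\dots,u_n$ with $\deg u_i=1$, and $du_i=x_i$, $dx_i=0$. Let $(A,d)$ be a differential graded algebra with graded-commutative cohomology, and let $\alpha_1,\alpha_2,\alpha_3\in H^*(A)$ be homogeneous with $\alpha_1\alpha_2=\alpha_2\alpha_3=0$. Pick cocycles $a_i$ representing $\alpha_i$ and $x,y\in A$ with $dx=a_1a_2$, $dy=a_2a_3$; then $xa_3-\bar a_1y$ is a cocycle, where $\bar a=(-1)^{|a|}a$. The Massey triple product $\langle\alpha_1,\alpha_2,\alpha_3\rangle$ is the set of cohomology classes of all such cocycles. It is decomposable if this set contains a class which is a product $\lambda\nu$ of two elements of $H^{>0}(A)$; otherwise it is indecomposable. *)

(* Defs.v *)
From HB Require Import structures.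
From mathcomp Require Import all_boot all_order all_algebra.
From mathcomp Require Import generic_quotient ring_quotient boolp mpoly.

Set Implicit Arguments.
Unset Strict Implicit.
Unset Printing Implicit Defensive.

Import GRing.Theory.
Local Open Scope ring_scope.
Local Open Scope quotient_scope.

(** * Two-sided ideals and quotient rings *)

Record ideal (A : pzRingType) := Ideal {
  ideal_mem :> A -> Prop;
  ideal0 : ideal_mem 0;
  idealB : forall a b, ideal_mem a -> ideal_mem b -> ideal_mem (a - b);
  idealMl : forall a b, ideal_mem b -> ideal_mem (a * b);
  idealMr : forall a b, ideal_mem a -> ideal_mem (a * b) }.

Lemma idealD (A : pzRingType) (I : ideal A) a b : I a -> I b -> I (a + b).
Proof.
by move=> Ia Ib; rewrite -[b]opprK; apply: idealB => //; rewrite -sub0r;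
   apply: idealB => //; exact: ideal0.
Qed.

Lemma ideal_sum (A : pzRingType) (I : ideal A) (J : Type) (r : seq J)
    (P : pred J) (F : J -> A) :
  (forall i, P i -> I (F i)) -> I (\sum_(i <- r | P i) F i).
Proof.
by move=> IF; apply: (big_ind I); [exact: ideal0|exact: idealD|].
Qed.

Inductive gen_ideal_mem (A : pzRingType) (G : A -> Prop) : A -> Prop :=
| gen_ideal0 : gen_ideal_mem G 0
| gen_idealD a g b c :
    G g -> gen_ideal_mem G c -> gen_ideal_mem G (a * g * b + c).

Section GenIdeal.
Variables (A : pzRingType) (G : A -> Prop).

Lemma gen_ideal_add a b :
  gen_ideal_mem G a -> gen_ideal_mem G b -> gen_ideal_mem G (a + b).
Proof.
move=> Ga Gb; elim: Ga => [|x g y c Gg _ IH]; first by rewrite add0r.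
by rewrite -addrA; apply: gen_idealD.
Qed.

Lemma gen_ideal_ml a b : gen_ideal_mem G b -> gen_ideal_mem G (a * b).
Proof.
elim=> [|x g y c Gg _ IH]; first by rewrite mulr0; apply: gen_ideal0.
by rewrite mulrDr !mulrA; apply: gen_idealD.
Qed.

Lemma gen_ideal_mr a b : gen_ideal_mem G a -> gen_ideal_mem G (a * b).
Proof.
elim=> [|x g y c Gg _ IH]; first by rewrite mul0r; apply: gen_ideal0.
by rewrite mulrDl -mulrA; apply: gen_idealD.
Qed.

Lemma gen_ideal_sub a b :
  gen_ideal_mem G a -> gen_ideal_mem G b -> gen_ideal_mem G (a - b).
Proof.
by move=> Ga Gb; apply: gen_ideal_add => //; rewrite -mulN1r; apply: gen_ideal_ml.
Qed.

Definition gen_ideal : ideal A :=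
  Ideal (gen_ideal0 G) gen_ideal_sub gen_ideal_ml gen_ideal_mr.

Lemma gen_ideal_gen g : G g -> gen_ideal g.
Proof.
by move=> Gg; have := gen_idealD 1 1 Gg (gen_ideal0 G);
   rewrite mul1r mulr1 addr0.
Qed.

End GenIdeal.

Section QuotientRing.
Variables (A : pzRingType) (I : ideal A).

Definition ideal_pred : {pred A} := fun a => `[< I a >].

Lemma ideal_pred_closed : zmod_closed ideal_pred.
Proof.
split; first by apply/asboolP; exact: ideal0.
by move=> a b /asboolP Ia /asboolP Ib; apply/asboolP; exact: idealB.
Qed.

HB.instance Definition _ :=
  GRing.isZmodClosed.Build A ideal_pred ideal_pred_closed.

Definition quotient_ring := Quotient.quot ideal_pred.
HB.instance Definition _ := GRing.Zmodule.on quotient_ring.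

Definition quot_pi (a : A) : quotient_ring := \pi a.

Lemma quot_piP a b : quot_pi a = quot_pi b <-> I (a - b).
Proof.
split=> [/eqP|Iab]; last apply/eqP.
  by rewrite -[_ == _]/(\pi_(Quotient.quot ideal_pred) a == \pi b)
             -Quotient.idealrBE => /asboolP.
rewrite -[_ == _]/(\pi_(Quotient.quot ideal_pred) a == \pi b).
by rewrite -Quotient.idealrBE; apply/asboolP.
Qed.

Lemma quot_piW (q : quotient_ring) : exists a, q = quot_pi a.
Proof. by exists (repr q); rewrite /quot_pi reprK. Qed.

Lemma quot_pi_zmod : zmod_morphism quot_pi.
Proof. by move=> a b; rewrite /quot_pi -[RHS]/(\pi_(Quotient.quot ideal_pred) a
  - \pi_(Quotient.quot ideal_pred) b) -raddfB. Qed.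

HB.instance Definition _ :=
  GRing.isZmodMorphism.Build A quotient_ring quot_pi quot_pi_zmod.

Definition quot_mul (q r : quotient_ring) : quotient_ring :=
  quot_pi (repr q * repr r).

Lemma quot_repr a : I (repr (quot_pi a) - a).
Proof. by apply/quot_piP; rewrite {1}/quot_pi reprK. Qed.

Lemma quot_mulE a b : quot_mul (quot_pi a) (quot_pi b) = quot_pi (a * b).
Proof.
apply/quot_piP; set a' := repr _; set b' := repr _.
have -> : a' * b' - a * b = a' * (b' - b) - (a' - a) * (- b).
  by rewrite mulrN opprK mulrBr mulrBl addrA subrK.
apply: idealB; first by apply: idealMl; exact: quot_repr.
by apply: idealMr; exact: quot_repr.
Qed.

Lemma quot_mulA : associative quot_mul.
Proof.
move=> q r s; have [a ->] := quot_piW q; have [b ->] := quot_piW r.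
by have [c ->] := quot_piW s; rewrite !quot_mulE mulrA.
Qed.
Lemma quot_mul1l : left_id (quot_pi 1) quot_mul.
Proof. by move=> q; have [a ->] := quot_piW q; rewrite quot_mulE mul1r. Qed.
Lemma quot_mul1r : right_id (quot_pi 1) quot_mul.
Proof. by move=> q; have [a ->] := quot_piW q; rewrite quot_mulE mulr1. Qed.
Lemma quot_mulDl : left_distributive quot_mul +%R.
Proof.
move=> q r s; have [a ->] := quot_piW q; have [b ->] := quot_piW r.
by have [c ->] := quot_piW s; rewrite -raddfD !quot_mulE -raddfD mulrDl.
Qed.
Lemma quot_mulDr : right_distributive quot_mul +%R.
Proof.
move=> q r s; have [a ->] := quot_piW q; have [b ->] := quot_piW r.
by have [c ->] := quot_piW s; rewrite -raddfD !quot_mulE -raddfD mulrDr.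
Qed.

HB.instance Definition _ := GRing.Zmodule_isPzRing.Build quotient_ring
  quot_mulA quot_mul1l quot_mul1r quot_mulDl quot_mulDr.

Lemma quot_pi_monoid : monoid_morphism quot_pi.
Proof. by split=> // a b; rewrite -quot_mulE. Qed.

HB.instance Definition _ :=
  GRing.isMonoidMorphism.Build A quotient_ring quot_pi quot_pi_monoid.

End QuotientRing.

(** * Gradings and differential graded algebras *)

Record grading (A : pzRingType) := Grading {
  gr :> nat -> A -> Prop;
  gr0 : forall p, gr p 0;
  grB : forall p a b, gr p a -> gr p b -> gr p (a - b);
  gr1 : gr 0%N 1;
  grM : forall p q a b, gr p a -> gr q b -> gr (p + q)%N (a * b);
  gr_sum : forall a, exists N (c : nat -> A),
    (forall p, gr p (c p)) /\ a = \sum_(p < N) c p;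
  gr_direct : forall N (c : nat -> A), (forall p, gr p (c p)) ->
    \sum_(p < N) c p = 0 -> forall p, (p < N)%N -> c p = 0 }.

(* The scalars of a DGA over a field enter neither its cohomology ring nor its
   Massey products, so only the underlying differential graded ring is kept. *)
Record dga := DGA {
  dga_ring :> pzRingType;
  deg : grading dga_ring;
  diff : {additive dga_ring -> dga_ring};
  diff_deg : forall p a, deg p a -> deg p.+1 (diff a);
  diff_diff : forall a, diff (diff a) = 0;
  diff_leibniz : forall p a b, deg p a ->
    diff (a * b) = diff a * b + (-1) ^+ p * a * diff b }.

Section GradingTheory.
Variables (A : pzRingType) (D : grading A).

Lemma grN p a : D p a -> D p (- a).
Proof. by move=> Da; rewrite -sub0r; apply: grB => //; exact: gr0. Qed.
Lemma grD p a b : D p a -> D p b -> D p (a + b).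
Proof. by move=> Da Db; rewrite -[b]opprK; apply: grB => //; exact: grN. Qed.

Lemma gr_big (J : Type) (r : seq J) (P : pred J) (F : J -> A) p :
  (forall i, P i -> D p (F i)) -> D p (\sum_(i <- r | P i) F i).
Proof.
by move=> DF; apply: big_ind => //; [exact: gr0 | exact: grD].
Qed.

Lemma gr_widen N M (c : nat -> A) : (N <= M)%N ->
  \sum_(p < N) c p = \sum_(p < M) (if (p < N)%N then c p else 0).
Proof.
by move=> leNM; rewrite (big_ord_widen M c leNM) -big_mkcond.
Qed.

(* uniqueness of finitely supported homogeneous decompositions *)
Lemma gr_uniq N M (c e : nat -> A) :
  (forall p, D p (c p)) -> (forall p, D p (e p)) ->
  \sum_(p < N) c p = \sum_(p < M) e p ->
  forall p, (if (p < N)%N then c p else 0) = (if (p < M)%N then e p else 0).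
Proof.
move=> Dc De Ece p; set K := (maxn p.+1 (maxn N M)).
have DI (f : nat -> A) L q : (forall p, D p (f p)) ->
  D q (if (q < L)%N then f q else 0) by move=> Df; case: ifP => // _; exact: gr0.
pose f q := (if (q < N)%N then c q else 0) - (if (q < M)%N then e q else 0).
have f0 : \sum_(q < K) f q = 0.
  by rewrite sumrB -!gr_widen ?Ece ?subrr // !leq_max leqnn !orbT.
apply/eqP; rewrite -subr_eq0; apply/eqP; apply: (gr_direct (g := D) _ f0).
  by move=> q; apply: grB; exact: DI.
by rewrite leq_max leqnn.
Qed.

End GradingTheory.

(** ** Quotient by an ideal generated by homogeneous elements *)

Section QuotientGrading.
Variables (A : pzRingType) (D : grading A) (G : A -> Prop).
Hypothesis Ghom : forall g, G g -> exists p, D p g.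
Local Notation I := (gen_ideal G).

Lemma gen_ideal_hom f : I f -> exists N (c : nat -> A),
  [/\ forall p, D p (c p), forall p, I (c p) & f = \sum_(p < N) c p].
Proof.
elim=> [|a g b f' Gg _ [N [c [Dc Ic ->]]]].
  exists 0%N, (fun=> 0); split=> [p|p|]; [exact: gr0|exact: ideal0|].
  by rewrite big_ord0.
have [q Dg] := Ghom Gg.
have [Na [ca [Dca ->]]] := gr_sum D a; have [Nb [cb [Dcb ->]]] := gr_sum D b.
pose e p := \sum_(i < Na) \sum_(j < Nb | (i + q + j == p)%N) ca i * g * cb j.
pose K := maxn N (Na + q + Nb)%N.
exists K, (fun p => e p + (if (p < N)%N then c p else 0)); split=> [p|p|].
- apply: grD; last by case: ifP => // _; exact: gr0.
  apply: gr_big => i _; apply: gr_big => j /eqP <-.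
  by apply: grM => //; apply: grM.
- apply: idealD; last by case: ifP => // _; exact: ideal0.
  apply: ideal_sum => i _.
  apply: ideal_sum => j _.
  by apply: idealMr; apply: idealMl; exact: gen_ideal_gen.
- rewrite big_split /= -gr_widen ?leq_maxl //; congr (_ + _).
  rewrite exchange_big /= mulr_suml mulr_suml; apply: eq_bigr => i _.
  rewrite mulr_sumr.
  rewrite (exchange_big_dep xpredT) //=; apply: eq_bigr => j _.
  have ltK : (i + q + j < K)%N.
    rewrite leq_max; apply/orP; right; rewrite -addnS leq_add //.
    by rewrite leq_add2r ltnW.
  by rewrite (big_pred1 (Ordinal ltK)).
Qed.

Definition quot_gr p (x : quotient_ring I) := exists2 a, D p a & x = quot_pi I a.

Fact quot_gr0 p : quot_gr p 0.
Proof. by exists 0; [exact: gr0|rewrite raddf0]. Qed.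
Fact quot_grB p a b : quot_gr p a -> quot_gr p b -> quot_gr p (a - b).
Proof.
by move=> [x Dx ->] [y Dy ->]; exists (x - y); [exact: grB|rewrite raddfB].
Qed.
Fact quot_gr1 : quot_gr 0 1.
Proof. by exists 1; [exact: gr1|rewrite rmorph1]. Qed.
Fact quot_grM p q a b : quot_gr p a -> quot_gr q b -> quot_gr (p + q) (a * b).
Proof.
by move=> [x Dx ->] [y Dy ->]; exists (x * y); [exact: grM|rewrite rmorphM].
Qed.
Fact quot_gr_sum a : exists N (c : nat -> quotient_ring I),
  (forall p, quot_gr p (c p)) /\ a = \sum_(p < N) c p.
Proof.
have [x ->] := quot_piW a; have [N [c [Dc ->]]] := gr_sum D x.
exists N, (fun p => quot_pi I (c p)); split=> [p|]; first by exists (c p).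
by rewrite raddf_sum.
Qed.
Fact quot_gr_direct N (c : nat -> quotient_ring I) :
  (forall p, quot_gr p (c p)) -> \sum_(p < N) c p = 0 ->
  forall p, (p < N)%N -> c p = 0.
Proof.
move=> Dc Ec.
have /choice[e He] : forall p, exists a, D p a /\ c p = quot_pi I a.
  by move=> p; have [a] := Dc p; exists a.
have De p : D p (e p) by have [] := He p.
have Ecp p : c p = quot_pi I (e p) by have [] := He p.
have /gen_ideal_hom[M [f [Df If Ef]]] : I (\sum_(p < N) e p).
  rewrite -[\sum_(p < N) e p]subr0; apply/quot_piP.
  by rewrite raddf_sum raddf0 -[RHS]Ec; apply: eq_bigr => p _; rewrite Ecp.
move=> p ltpN; rewrite Ecp -(raddf0 (quot_pi I)); apply/quot_piP; rewrite subr0.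
have := gr_uniq De Df Ef p; rewrite ltpN => ->.
by case: ifP => // _; exact: ideal0.
Qed.

Definition quot_grading : grading (quotient_ring I) :=
  Grading quot_gr0 quot_grB quot_gr1 quot_grM quot_gr_sum quot_gr_direct.

End QuotientGrading.

Section QuotientDGA.
Variables (A : dga) (G : A -> Prop).
Hypothesis Ghom : forall g, G g -> exists p, deg A p g.
Hypothesis Gdiff : forall g, G g -> gen_ideal G (diff A g).
Local Notation I := (gen_ideal G).

Lemma diff_mem_ideal f : I f -> I (diff A f).
Proof.
elim=> [|a g b f' Gg _ If']; first by rewrite raddf0; exact: ideal0.
have Ig : I g by exact: gen_ideal_gen.
have [q Dg] := Ghom Gg; have [N [c [Dc ->]]] := gr_sum (deg A) a.
rewrite raddfD; apply: (idealD (I := I)) => //.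
rewrite !mulr_suml raddf_sum; apply: (ideal_sum (I := I)) => i _.
rewrite (diff_leibniz (p := (i + q)%N)); last exact: grM.
rewrite (diff_leibniz _ (Dc i)).
apply: (idealD (I := I)).
  apply: (idealMr (i := I)); apply: (idealD (I := I)).
    exact: (idealMl (i := I)).
  by apply: (idealMl (i := I)); exact: Gdiff.
apply: (idealMr (i := I)); apply: (idealMl (i := I)).
exact: (idealMl (i := I)).
Qed.

Definition quot_diff (x : quotient_ring I) : quotient_ring I :=
  quot_pi I (diff A (repr x)).

Lemma quot_diffE a : quot_diff (quot_pi I a) = quot_pi I (diff A a).
Proof.
by apply/quot_piP; rewrite -raddfB; apply: diff_mem_ideal; exact: quot_repr.
Qed.

Lemma quot_diff_zmod : zmod_morphism quot_diff.
Proof.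
move=> x y; have [a ->] := quot_piW x; have [b ->] := quot_piW y.
by rewrite -raddfB !quot_diffE -!raddfB.
Qed.

HB.instance Definition _ := GRing.isZmodMorphism.Build
  (quotient_ring I) (quotient_ring I) quot_diff quot_diff_zmod.

Fact quot_diff_deg p x :
  quot_grading Ghom p x -> quot_grading Ghom p.+1 (quot_diff x).
Proof.
move=> [a Da ->]; exists (diff A a); first exact: diff_deg.
by rewrite quot_diffE.
Qed.
Fact quot_diff_diff x : quot_diff (quot_diff x) = 0.
Proof.
by have [a ->] := quot_piW x; rewrite !quot_diffE diff_diff raddf0.
Qed.
Fact quot_diff_leibniz p x y : quot_grading Ghom p x ->
  quot_diff (x * y) = quot_diff x * y + (-1) ^+ p * x * quot_diff y.
Proof.
move=> [a Da ->]; have [b ->] := quot_piW y.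
rewrite -rmorphM !quot_diffE (diff_leibniz _ Da) raddfD /= !rmorphM /=.
by rewrite rmorph_sign.
Qed.

Definition quot_dga : dga :=
  @DGA (quotient_ring I) (quot_grading Ghom) quot_diff
    quot_diff_deg quot_diff_diff quot_diff_leibniz.

End QuotientDGA.

(** * Cohomology *)

Section Cohomology.
Variable A : dga.
Local Notation d := (diff A).

Lemma diff_cocycle_mul a : d a = 0 -> exists a', forall c,
  d (a * c) = a' * d c /\ a * d c = d (a' * c).
Proof.
have [N [c [Dc ->]]] := gr_sum (deg A) a => da0.
have dc0 p : (p < N)%N -> d (c p) = 0.
  move=> ltpN; pose e q := if q is q'.+1 then d (c q') else 0.
  have De q : deg A q (e q) by case: q => [|q]; [exact: gr0|exact: diff_deg].
  apply: (gr_direct (N := N.+1) De _ (p := p.+1)) => //.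
  by rewrite big_ord_recl add0r -[RHS]da0 raddf_sum.
have dcM (p : 'I_N) x : d (c p * x) = (-1) ^+ p * c p * d x.
  by rewrite (diff_leibniz _ (Dc p)) dc0 // mul0r add0r.
exists (\sum_(p < N) (-1) ^+ p * c p) => x; split.
  by rewrite !mulr_suml raddf_sum; apply: eq_bigr => p _; rewrite dcM.
rewrite !mulr_suml raddf_sum; apply: eq_bigr => p _.
have sgn y : (-1) ^+ p * y = y *~ ((-1) ^+ p) :> A.
  by rewrite -mulrzl rmorph_sign.
rewrite -mulrA sgn raddfMz dcM -mulrA sgn -mulrzA -expr2 -signr_odd.
by rewrite sqrr_sign mulr1z.
Qed.

Lemma diff1 : d 1 = 0.
Proof.
have := diff_leibniz 1 (gr1 (deg A)); rewrite !mulr1 !mul1r => /eqP.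
by rewrite -subr_eq subrr eq_sym => /eqP.
Qed.

Definition cocycle_pred : {pred A} := fun a => d a == 0.

Fact cocycle_closed : subring_closed cocycle_pred.
Proof.
split=> [|a b|a b]; first by apply/eqP; exact: diff1.
  by move=> /eqP da /eqP db; apply/eqP; rewrite raddfB da db subr0.
move=> /eqP da /eqP db; apply/eqP.
by have [a' /(_ b)[-> _]] := diff_cocycle_mul da; rewrite db mulr0.
Qed.

HB.instance Definition _ :=
  GRing.isSubringClosed.Build A cocycle_pred cocycle_closed.

Record cocycle := Cocycle { cocycle_val : A; _ : cocycle_val \in cocycle_pred }.

HB.instance Definition _ := [isSub for cocycle_val].
HB.instance Definition _ := [Choice of cocycle by <:].
HB.instance Definition _ :=
  GRing.SubChoice_isSubPzRing.Build A cocycle_pred cocycle cocycle_closed.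

Lemma cocycleE (z : cocycle) : d (val z) = 0.
Proof. by apply/eqP; exact: (valP z). Qed.

Definition coboundary_mem (z : cocycle) := exists c : A, d c = val z.

Fact coboundary0 : coboundary_mem 0.
Proof. by exists 0; rewrite !raddf0. Qed.
Fact coboundaryB z w :
  coboundary_mem z -> coboundary_mem w -> coboundary_mem (z - w).
Proof. by move=> [a da] [b db]; exists (a - b); rewrite !raddfB da db. Qed.
Fact coboundaryMl z w : coboundary_mem w -> coboundary_mem (z * w).
Proof.
move=> [c dc]; have [z' Hz] := diff_cocycle_mul (cocycleE z).
by exists (z' * c); rewrite -(Hz c).2 dc.
Qed.
Fact coboundaryMr z w : coboundary_mem z -> coboundary_mem (z * w).
Proof.
move=> [c dc]; have [N [e [De Ee]]] := gr_sum (deg A) c.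
exists (c * val w); rewrite -[RHS]/(val z * val w) -dc Ee raddf_sum !mulr_suml raddf_sum.
apply: eq_bigr => p _.
by rewrite (diff_leibniz _ (De p)) cocycleE mulr0 addr0.
Qed.

Definition coboundary : ideal cocycle :=
  Ideal coboundary0 coboundaryB coboundaryMl coboundaryMr.

Definition cohomology : pzRingType := quotient_ring coboundary.

Definition represents (a : A) (alpha : cohomology) :=
  exists2 z : cocycle, val z = a & quot_pi coboundary z = alpha.

Definition coh (p : nat) (alpha : cohomology) :=
  exists2 a, deg A p a & represents a alpha.

(* H^{>0} is the direct sum of the H^p with p > 0, so its elements need not be
   homogeneous. *)
Definition coh_pos (alpha : cohomology) :=
  exists N (c : nat -> cohomology),
    (forall p, coh p.+1 (c p)) /\ alpha = \sum_(p < N) c p.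

(* A^{p-1}, which is zero for p = 0 *)
Definition deg_pred (p : nat) (a : A) :=
  if p is p'.+1 then deg A p' a else a = 0.

(* The degrees p, q, r of the three classes are explicit because the sign
   depends on them and they are not determined by a vanishing class. *)
Definition massey (p q r : nat) (alpha beta gamma omega : cohomology) :=
  exists a1 a2 a3 x y : A,
    [/\ deg A p a1 /\ represents a1 alpha,
        deg A q a2 /\ represents a2 beta,
        deg A r a3 /\ represents a3 gamma,
        [/\ deg_pred (p + q) x, d x = a1 * a2,
            deg_pred (q + r) y & d y = a2 * a3]
      & represents (x * a3 - (-1) ^+ p * a1 * y) omega].

Definition decomposable (M : cohomology -> Prop) :=
  exists lambda nu,
    [/\ coh_pos lambda, coh_pos nu & M (lambda * nu)].

End Cohomology.

(** * The Koszul complex *)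

Section ExteriorSign.
Variable n : nat.
Implicit Types J L M N P Q : {set 'I_n}.

Definition inversions J M : nat :=
  (\sum_(j in J) \sum_(m in M) (m < j : nat))%N.

(* the structure constants of the exterior algebra: for the basis elements
   u_J = u_(j_1) ... u_(j_k) with j_1 < ... < j_k,
   u_J u_M = ext_sign J M * u_(J :|: M) *)
Definition ext_sign J M : int :=
  if [disjoint J & M] then (-1) ^+ inversions J M else 0.

Lemma sum_setU J M (F : 'I_n -> nat) : [disjoint J & M] ->
  (\sum_(i in J :|: M) F i = \sum_(i in J) F i + \sum_(i in M) F i)%N.
Proof.
by move=> dJM; rewrite -bigU //=; apply: eq_bigl => i; rewrite !inE.
Qed.

Lemma inversionsUl J M N : [disjoint J & M] ->
  inversions (J :|: M) N = (inversions J N + inversions M N)%N.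
Proof. by move=> dJM; rewrite /inversions sum_setU. Qed.

Lemma inversionsUr J M N : [disjoint M & N] ->
  inversions J (M :|: N) = (inversions J M + inversions J N)%N.
Proof.
move=> dMN; rewrite /inversions -big_split /=; apply: eq_bigr => j _.
by rewrite sum_setU.
Qed.

Lemma ext_signA J M N :
  ext_sign J M * ext_sign (J :|: M) N = ext_sign M N * ext_sign J (M :|: N).
Proof.
have disjU (X Y Z : {set 'I_n}) :
    [disjoint X :|: Y & Z] = [disjoint X & Z] && [disjoint Y & Z].
  by rewrite !disjoints_subset subUset.
rewrite /ext_sign (disjoint_sym J (M :|: N)) !disjU.
rewrite (disjoint_sym M J) (disjoint_sym N J).
have [dJM|] := boolP [disjoint J & M]; last by rewrite !mul0r mulr0.
have [dMN|] := boolP [disjoint M & N]; last by rewrite andbF mulr0 mul0r.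
rewrite andbT /=; case: ifP => _; last by rewrite !mulr0.
rewrite inversionsUl // inversionsUr // -!exprD; congr (_ ^+ _).
by rewrite addnA [RHS]addnC.
Qed.

Lemma ext_sign0l M : ext_sign set0 M = 1.
Proof.
rewrite /ext_sign /inversions big_set0 expr0 disjoints_subset sub0set //.
Qed.
Lemma ext_sign0r M : ext_sign M set0 = 1.
Proof.
rewrite /ext_sign disjoint_sym disjoints_subset sub0set /inversions big1 //.
by move=> j _; rewrite big_set0.
Qed.

Lemma ext_sign_mem j L : j \in L -> ext_sign [set j] L = 0.
Proof. by move=> jL; rewrite /ext_sign disjoints1 jL. Qed.

Lemma ext_sign_sqr j L : j \notin L -> ext_sign [set j] L * ext_sign [set j] L = 1.
Proof.
by move=> jL; rewrite /ext_sign disjoints1 jL -expr2 sqrr_sign.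
Qed.

Lemma ext_signC1 j L :
  ext_sign L [set j] = (-1) ^+ #|L| * ext_sign [set j] L.
Proof.
rewrite /ext_sign (disjoint_sym L) disjoints1.
case: ifPn => [jL|_]; last by rewrite mulr0.
rewrite -exprD -[LHS]signr_odd -[RHS]signr_odd; congr (_ ^+ nat_of_bool _).
rewrite /inversions big_set1 -sum1_card oddD.
rewrite (eq_bigr (fun l : 'I_n => (j < l)%N : nat)); last first.
  by move=> l _; rewrite big_set1.
rewrite -oddD -big_split /= !(big_morph odd oddD (erefl _)).
apply: eq_bigr => l lL; rewrite oddD.
by case: (ltngtP l j) => // /val_inj El; rewrite -El lL in jL.
Qed.

End ExteriorSign.

(* R (x) E as a free R-module: the coefficient of u_J in f is f J. Elements of R
   are given even degree below, so that they commute with the u_i without sign. *)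
Definition exterior (R : pzRingType) (n : nat) := {ffun {set 'I_n} -> R}.

Section ExteriorRing.
Variables (R : pzRingType) (n : nat).
Implicit Types (f g h : exterior R n) (J L M N P Q : {set 'I_n}).

HB.instance Definition _ :=
  GRing.Zmodule.copy (exterior R n) {ffun {set 'I_n} -> R}.

Definition ext_one : exterior R n := [ffun J => (J == set0)%:R].

Definition ext_mul f g : exterior R n :=
  [ffun L => \sum_J \sum_(M | J :|: M == L) (f J * g M) *~ ext_sign J M].

Lemma ext_sum_collapse (V : zmodType) (C : pred {set 'I_n})
    (F : {set 'I_n} -> {set 'I_n} -> {set 'I_n} -> V) :
  \sum_(P | C P) \sum_M \sum_(N | M :|: N == P) F M N P =
  \sum_M \sum_(N | C (M :|: N)) F M N (M :|: N).
Proof.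
rewrite exchange_big /=; apply: eq_bigr => M _.
rewrite (exchange_big_dep (fun N => C (M :|: N))) /=; last by move=> P N CP /eqP->.
apply: eq_bigr => N CMN; apply: big_pred1 => P.
by rewrite /= eq_sym; case: eqP => [->|]; rewrite ?CMN ?andbF.
Qed.

Lemma ext_mulA : associative ext_mul.
Proof.
move=> f g h; apply/ffunP => L; rewrite !ffunE.
transitivity (\sum_J \sum_M \sum_(N | J :|: (M :|: N) == L)
    (f J * g M * h N) *~ (ext_sign M N * ext_sign J (M :|: N))).
  apply: eq_bigr => J _.
  rewrite -(ext_sum_collapse (fun P => J :|: P == L) (fun M N P =>
    (f J * g M * h N) *~ (ext_sign M N * ext_sign J P))).
  apply: eq_bigr => P _; rewrite ffunE mulr_sumr mulrz_suml; apply: eq_bigr => M _.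
  rewrite mulr_sumr mulrz_suml; apply: eq_bigr => N _.
  by rewrite mulrzAr mulrA mulrzA.
apply/esym; rewrite (exchange_big_dep xpredT) //=.
transitivity (\sum_N \sum_J \sum_(M | J :|: M :|: N == L)
    (f J * g M * h N) *~ (ext_sign J M * ext_sign (J :|: M) N)).
  apply: eq_bigr => N _.
  rewrite -(ext_sum_collapse (fun P => P :|: N == L) (fun J M P =>
    (f J * g M * h N) *~ (ext_sign J M * ext_sign P N))).
  apply: eq_bigr => P _; rewrite ffunE mulr_suml mulrz_suml; apply: eq_bigr => J _.
  rewrite mulr_suml mulrz_suml; apply: eq_bigr => M _.
  by rewrite mulrzAl mulrzA.
rewrite exchange_big; apply: eq_bigr => J _ /=.
rewrite (exchange_big_dep xpredT) //=; apply: eq_bigr => M _.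
by apply: eq_big => [N|N _]; rewrite ?setUA ?ext_signA.
Qed.

Lemma ext_mul1l : left_id ext_one ext_mul.
Proof.
move=> f; apply/ffunP => L; rewrite ffunE (bigD1 set0) //= [X in _ + X]big1 ?addr0 => [|J J0].
  rewrite (big_pred1 L) => [|M]; last by rewrite /= set0U.
  by rewrite ffunE eqxx mul1r ext_sign0l.
by rewrite big1 // => M _; rewrite ffunE (negPf J0) mul0r mul0rz.
Qed.

Lemma ext_mul1r : right_id ext_one ext_mul.
Proof.
move=> f; apply/ffunP => L; rewrite ffunE (bigD1 L) //= [X in _ + X]big1 ?addr0 => [|J JL].
  rewrite (bigD1 set0) ?setU0 //= [X in _ + X]big1 ?addr0 => [|M /andP[_ M0]].
    by rewrite ffunE eqxx mulr1 ext_sign0r.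
  by rewrite ffunE (negPf M0) mulr0 mul0rz.
rewrite big1 // => M /eqP JML; rewrite ffunE; case: eqP => [M0|_].
  by rewrite -JML M0 setU0 eqxx in JL.
by rewrite mulr0 mul0rz.
Qed.

Lemma ext_mulDl : left_distributive ext_mul +%R.
Proof.
move=> f g h; apply/ffunP => L; rewrite !ffunE -big_split; apply: eq_bigr => J _.
rewrite -big_split; apply: eq_bigr => M _.
by rewrite !ffunE mulrDl mulrzDl.
Qed.

Lemma ext_mulDr : right_distributive ext_mul +%R.
Proof.
move=> f g h; apply/ffunP => L; rewrite !ffunE -big_split; apply: eq_bigr => J _.
rewrite -big_split; apply: eq_bigr => M _.
by rewrite !ffunE mulrDr mulrzDl.
Qed.

HB.instance Definition _ := GRing.Zmodule_isPzRing.Build (exterior R n)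
  ext_mulA ext_mul1l ext_mul1r ext_mulDl ext_mulDr.

Definition ext_scalar (r : R) : exterior R n := [ffun J => if J == set0 then r else 0].
Definition ext_gen (i : 'I_n) : exterior R n := [ffun J => (J == [set i])%:R].

End ExteriorRing.

Section KoszulComplex.
Variables (R : pzRingType) (D : grading R) (n : nat) (x : 'I_n -> R).
Hypothesis Deven : forall p a, odd p -> D p a -> a = 0.
Hypothesis Dx : forall i, D 2%N (x i).
Hypothesis xC : forall i a, x i * a = a * x i.
Local Notation K := (exterior R n).
Implicit Types (f g h : K) (J L M P Q : {set 'I_n}).

(* f has degree p when each coefficient f J has degree p - #|J|, zero if #|J| > p *)
Definition shift_gr p m (a : R) := if (m <= p)%N then D (p - m)%N a else a = 0.
Definition koszul_gr (p : nat) f := forall J, shift_gr p #|J| (f J).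

Lemma shift_gr0 p m : shift_gr p m 0.
Proof. by rewrite /shift_gr; case: ifP => // _; exact: gr0. Qed.
Lemma shift_grB p m a b : shift_gr p m a -> shift_gr p m b -> shift_gr p m (a - b).
Proof.
rewrite /shift_gr; case: ifP => _; first exact: grB.
by move=> -> ->; rewrite subrr.
Qed.
Lemma shift_grD p m a b : shift_gr p m a -> shift_gr p m b -> shift_gr p m (a + b).
Proof.
move=> Da Db; rewrite -[b]opprK; apply: shift_grB => //; rewrite -sub0r.
by apply: shift_grB => //; exact: shift_gr0.
Qed.
Lemma shift_gr_sum p m (I : Type) (r : seq I) (C : pred I) (F : I -> R) :
  (forall i, C i -> shift_gr p m (F i)) -> shift_gr p m (\sum_(i <- r | C i) F i).
Proof.
by move=> DF; apply: (big_ind (shift_gr p m)) => //;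
   [exact: shift_gr0|exact: shift_grD].
Qed.
Lemma shift_gr_sign p m J M a : shift_gr p m a -> shift_gr p m (a *~ ext_sign J M).
Proof.
rewrite /ext_sign; case: ifP => _ Da; last by rewrite mulr0z; exact: shift_gr0.
rewrite -signr_odd; case: (odd _); rewrite ?expr1 ?expr0 ?mulrN1z ?mulr1z //.
by rewrite -sub0r; apply: shift_grB => //; exact: shift_gr0.
Qed.
Lemma shift_grM p q m l a b :
  shift_gr p m a -> shift_gr q l b -> shift_gr (p + q) (m + l) (a * b).
Proof.
rewrite {1 2}/shift_gr; case: leqP => [mp Da|_ ->]; last first.
  by rewrite mul0r => _; exact: shift_gr0.
case: leqP => [lq Db|_ ->]; last by rewrite mulr0; exact: shift_gr0.
by rewrite /shift_gr leq_add // subnDA -addnBAC // -addnBA // ; exact: grM.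
Qed.

Fact koszul_gr0 p : koszul_gr p 0.
Proof. by move=> J; rewrite ffunE; exact: shift_gr0. Qed.
Fact koszul_grB p f g : koszul_gr p f -> koszul_gr p g -> koszul_gr p (f - g).
Proof. by move=> Df Dg J; rewrite !ffunE; exact: shift_grB. Qed.
Fact koszul_gr1 : koszul_gr 0 1.
Proof.
move=> J; rewrite ffunE; have [->|_] := eqVneq; last exact: shift_gr0.
by rewrite cards0; exact: gr1.
Qed.

Lemma ext_sign_card J M a p L : J :|: M = L ->
  shift_gr p (#|J| + #|M|) a -> shift_gr p #|L| (a *~ ext_sign J M).
Proof.
move=> <-; case: (boolP [disjoint J & M]) => dJM.
  by rewrite cardsU (eqP (_ : J :&: M == set0)) ?setI_eq0 // cards0 subn0;
     exact: shift_gr_sign.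
by rewrite /ext_sign (negPf dJM) mulr0z => _; exact: shift_gr0.
Qed.

Fact koszul_grM p q f g :
  koszul_gr p f -> koszul_gr q g -> koszul_gr (p + q) (f * g).
Proof.
move=> Df Dg L; rewrite ffunE; apply: shift_gr_sum => J _.
by apply: shift_gr_sum => M /eqP JML; apply: ext_sign_card JML _; exact: shift_grM.
Qed.

Fact koszul_gr_sum f : exists N (c : nat -> K),
  (forall p, koszul_gr p (c p)) /\ f = \sum_(p < N) c p.
Proof.
have /choice[N /choice[c Hc]] : forall J, exists N (c : nat -> R),
    (forall p, D p (c p)) /\ f J = \sum_(p < N) c p.
  by move=> J; exact: gr_sum.
pose B := (\max_(J : {set 'I_n}) (#|J| + N J))%N.
have leB J : (#|J| + N J <= B)%N by exact: (leq_bigmax_cond (F := fun J : {set _} => #|J| + N J)%N).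
pose e J p := if (#|J| <= p)%N && (p - #|J| < N J)%N
  then c J (p - #|J|)%N else 0.
exists B, (fun p => [ffun J => e J p]); split=> [p J|].
  rewrite ffunE /e; case: ifP => [/andP[lJp _]|_]; last exact: shift_gr0.
  by rewrite /shift_gr lJp; exact: (Hc J).1.
apply/ffunP => J; rewrite (Hc J).2 sum_ffunE.
rewrite (eq_bigr (fun p : 'I_B => e J p)); last by move=> p _; rewrite ffunE.
rewrite -(big_mkord xpredT (e J)) /e.
rewrite (big_cat_nat _ (n := #|J|)) //=; last exact: leq_trans (leq_addr _ _) (leB J).
rewrite [X in X + _]big_nat_cond [X in X + _]big1 ?add0r => [|p]; last first.
  by rewrite andbT => /andP[_ ltpJ]; rewrite leqNgt ltpJ.
rewrite -[X in \sum_(X <= _ < _) _]add0n big_addn big_mkord.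
have leNB : (N J <= B - #|J|)%N by rewrite leq_subRL // (leq_trans _ (leB J)) ?leq_addr.
rewrite (big_ord_widen _ (c J) leNB) big_mkcond /=; apply: eq_bigr => p _.
by rewrite leq_addl addnK.
Qed.

Fact koszul_gr_direct N (c : nat -> K) : (forall p, koszul_gr p (c p)) ->
  \sum_(p < N) c p = 0 -> forall p, (p < N)%N -> c p = 0.
Proof.
move=> Dc c0 p ltpN; apply/ffunP => J; rewrite ffunE.
case: (leqP #|J| p) => leJp; last by have := Dc p J; rewrite /shift_gr leqNgt leJp.
pose e q := c (q + #|J|)%N J.
have De q : D q (e q) by have := Dc (q + #|J|)%N J; rewrite /shift_gr leq_addl addnK.
suff e0 : \sum_(q < N - #|J|) e q = 0.
  have := gr_direct De e0 (p := (p - #|J|)%N).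
  by rewrite /e subnK //; apply; rewrite ltn_sub2r // (leq_ltn_trans leJp).
have : (\sum_(p < N) c p) J = 0 by rewrite c0 ffunE.
rewrite sum_ffunE -(big_mkord xpredT (fun p => c p J)).
rewrite (big_cat_nat _ (n := #|J|)) //=; last by rewrite ltnW // (leq_ltn_trans leJp).
rewrite [X in X + _]big_nat_cond [X in X + _]big1 ?add0r => [|q]; last first.
  rewrite andbT => /andP[_ ltqJ]; have := Dc q J.
  by rewrite /shift_gr leqNgt ltqJ.
by rewrite -[X in \sum_(X <= _ < _) _]add0n big_addn big_mkord.
Qed.

Definition koszul_grading : grading K :=
  Grading koszul_gr0 koszul_grB koszul_gr1 koszul_grM koszul_gr_sum koszul_gr_direct.

(* the R-linear map with
   u_(j_1) ... u_(j_k) |-> sum_s (-1)^(s-1) x_(j_s) u_(j_1) .. (omit u_(j_s)) .. u_(j_k),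
   that is, the derivation with d u_i = x_i and d r = 0 for r in R *)
Definition koszul_diff f : K :=
  [ffun L => \sum_j (x j * f (j |: L)) *~ ext_sign [set j] L].

Lemma koszul_diff_zmod : zmod_morphism koszul_diff.
Proof.
move=> f g; apply/ffunP => L; rewrite !ffunE -sumrB; apply: eq_bigr => j _.
by rewrite !ffunE mulrBr mulrzBl.
Qed.

HB.instance Definition _ :=
  GRing.isZmodMorphism.Build K K koszul_diff koszul_diff_zmod.

Fact koszul_diff_deg p f : koszul_grading p f -> koszul_grading p.+1 (koszul_diff f).
Proof.
move=> Df L; rewrite ffunE; apply: shift_gr_sum => j _.
case: (boolP (j \in L)) => [jL|jL].
  by rewrite ext_sign_mem // mulr0z; exact: shift_gr0.
apply: shift_gr_sign; have := Df (j |: L); rewrite cardsU1 jL add1n => Hf.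
have : shift_gr (2 + p) (0 + #|L|.+1) (x j * f (j |: L)).
  by apply: shift_grM => //; exact: Dx.
by rewrite /shift_gr add0n add2n ltnS subSS.
Qed.

Fact koszul_diff_diff f : koszul_diff (koszul_diff f) = 0.
Proof.
apply/ffunP => L; rewrite !ffunE.
pose t j i := (x j * x i * f (i |: (j |: L))) *~ (ext_sign [set j] L * ext_sign [set i] (j |: L)).
have -> : \sum_j (x j * koszul_diff f (j |: L)) *~ ext_sign [set j] L = \sum_j \sum_i t j i.
  apply: eq_bigr => j _; rewrite ffunE mulr_sumr mulrz_suml; apply: eq_bigr => i _.
  by rewrite mulrzAr mulrA -mulrzA mulrC.
have t0 j : t j j = 0 by rewrite /t [ext_sign _ (_ |: _)]ext_sign_mem ?mulr0 ?mulr0z // setU11.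
have tN (i j : 'I_n) : i != j -> t j i = - t i j.
  move=> nij; rewrite /t xC setUCA -mulrNz; congr (_ *~ _).
  rewrite -!ext_signA -mulNr [j |: _]setUC; congr (_ * _).
  by rewrite ext_signC1 cards1 expr1 mulN1r.
rewrite (eq_bigr (fun j : 'I_n => \sum_(i : 'I_n | (i < j)%N) t j i +
    \sum_(i : 'I_n | (j < i)%N) t j i)).
  rewrite big_split /= [X in _ + X](exchange_big_dep xpredT) //= -big_split /=.
  rewrite big1 // => j _; rewrite -big_split /= big1 // => i ltij.
  by rewrite tN ?addNr // neq_ltn ltij.
move=> j _; rewrite (bigID (fun i : 'I_n => (i < j)%N)) /=; congr (_ + _).
rewrite (bigD1 j) ?ltnn //= t0 add0r; apply: eq_bigl => i.
by rewrite -leqNgt [RHS]ltn_neqAle andbC eq_sym.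
Qed.

Lemma setU1_eq j L M : j \notin L -> j \notin M -> (j |: L == j |: M) = (L == M).
Proof.
move=> jL jM; apply/eqP/eqP => [/(congr1 (fun P => P :\ j))|-> //].
by rewrite !setU1K.
Qed.

Lemma koszul_coef j P Q L :
  (if P :|: Q == j |: L then ext_sign P Q * ext_sign [set j] L else 0) =
  (if j \in P then ext_sign [set j] (P :\ j) *
     (if P :\ j :|: Q == L then ext_sign (P :\ j) Q else 0) else 0) +
  (if j \in Q then ext_sign [set j] (Q :\ j) * ((-1) ^+ #|P| *
     (if P :|: Q :\ j == L then ext_sign P (Q :\ j) else 0)) else 0).
Proof.
have swap (a b c e : int) : a * a = 1 -> b * b = 1 -> b * c = a * e -> a * c = b * e.
  move=> aa bb bc; rewrite -[c]mul1r -bb -[b * b * c]mulrA bc.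
  by rewrite mulrCA (mulrA a a) aa mul1r.
have sqr := ext_sign_sqr.
have jD (X : {set 'I_n}) : j \notin X :\ j by rewrite !inE eqxx.
have [jP|jP] := boolP (j \in P); have [jQ|jQ] := boolP (j \in Q).
- have -> : ext_sign P Q = 0.
    by rewrite /ext_sign; case: ifP => // /pred0P/(_ j)/=; rewrite jP jQ.
  have EP := setD1K jP; have EQ := setD1K jQ.
  have cP : #|P| = #|P :\ j|.+1 by rewrite (cardsD1 j P) jP.
  set P' := P :\ j in EP cP *; set Q' := Q :\ j in EQ *.
  have EU : P' :|: Q = P :|: Q' by rewrite -EP -EQ setUCA setUA.
  rewrite mul0r if_same EU; case: eqP => _; last by rewrite !mulr0 addr0.
  have key : ext_sign [set j] Q' * ext_sign P' Q =
             ext_sign [set j] P' * ((-1) ^+ #|P'| * ext_sign P Q').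
    by rewrite -{1}EQ -ext_signA ext_signC1 [P' :|: _]setUC EP -mulrA mulrCA.
  have -> : ext_sign [set j] P' * ext_sign P' Q =
            ext_sign [set j] Q' * ((-1) ^+ #|P'| * ext_sign P Q').
    exact: (swap _ _ _ _ (ext_sign_sqr (jD P)) (ext_sign_sqr (jD Q)) key).
  by rewrite cP exprS mulN1r mulNr mulrN subrr.
- rewrite addr0; case: (boolP (j \in L)) => jL.
    rewrite (ext_sign_mem jL) mulr0 if_same; case: eqP => [EL|]; last by rewrite mulr0.
    by move: jL; rewrite -EL !inE eqxx (negPf jQ).
  rewrite -{1 2}(setD1K jP) -setUA setU1_eq ?inE ?eqxx ?(negPf jQ) //.
  case: eqP => [EL|]; last by rewrite mulr0.
  rewrite mulrC; apply: swap; rewrite ?sqr //.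
  by rewrite ext_signA mulrC EL.
- rewrite add0r; case: (boolP (j \in L)) => jL.
    rewrite (ext_sign_mem jL) mulr0 if_same; case: eqP => [EL|]; last by rewrite !mulr0.
    by move: jL; rewrite -EL !inE eqxx (negPf jP).
  rewrite -{1 2}(setD1K jQ) setUCA setU1_eq ?inE ?eqxx ?(negPf jP) //.
  case: eqP => [EL|]; last by rewrite !mulr0.
  rewrite mulrC; apply: swap; rewrite ?sqr //.
  rewrite -ext_signA ext_signC1 [_ :|: [set j]]setUC -mulrA ext_signA EL.
  by rewrite [ext_sign P _ * _]mulrC mulrCA.
- rewrite addr0; case: eqP => // /setP/(_ j).
  by rewrite !inE eqxx (negPf jP) (negPf jQ).
Qed.

Lemma koszul_reindex j (F : {set 'I_n} -> R) (w : {set 'I_n} -> int) :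
  \sum_J F (j |: J) *~ (ext_sign [set j] J * w J) =
  \sum_P F P *~ (if j \in P then ext_sign [set j] (P :\ j) * w (P :\ j) else 0).
Proof.
rewrite (bigID (fun J => j \in J)) /= big1 ?add0r => [|J jJ]; last first.
  by rewrite ext_sign_mem // mul0r mulr0z.
rewrite [RHS](bigID (fun J => j \in J)) /= [X in _ = _ + X]big1 ?addr0; last first.
  by move=> J /negPf ->; rewrite mulr0z.
rewrite (reindex_onto (fun P => P :\ j) (fun J => j |: J)) /=; last first.
  by move=> J jJ; rewrite setU1K.
apply: eq_big => [P|P /andP[_ /eqP EP]].
  rewrite !inE eqxx /=; apply/eqP/idP => [<-|jP]; first by rewrite setU11.
  by rewrite setD1K.
have jP : j \in P by rewrite -EP setU11.
by rewrite jP setD1K.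
Qed.

Lemma koszul_sign p f P : koszul_grading p f ->
  ((-1) ^+ p * f : K) P = f P *~ ((-1) ^+ #|P|).
Proof.
move=> /(_ P); rewrite /shift_gr -signr_odd mulr_sign; case: leqP => [leP DP|_ f0]; last first.
  by rewrite f0 mul0rz; case: ifP => _; rewrite ?ffunE ?f0 ?oppr0.
have [odd_pP|even_pP] := boolP (odd (p - #|P|)%N).
  have f0 := Deven odd_pP DP.
  by rewrite f0 mul0rz; case: ifP => _; rewrite ?ffunE ?f0 ?oppr0.
rewrite -[p in odd p](subnK leP) oddD (negPf even_pP) /= -signr_odd.
by case: (odd _); rewrite ?ffunE ?expr1 ?expr0 ?mulrN1z ?mulr1z.
Qed.

Fact koszul_leibniz p f g : koszul_grading p f ->
  koszul_diff (f * g) = koszul_diff f * g + (-1) ^+ p * f * koszul_diff g.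
Proof.
move=> Df; apply/ffunP => L; rewrite [RHS]ffunE [LHS]ffunE.
pose T j P Q := x j * f P * g Q.
transitivity (\sum_j \sum_P \sum_Q T j P Q *~
    (if P :|: Q == j |: L then ext_sign P Q * ext_sign [set j] L else 0)).
  apply: eq_bigr => j _; rewrite ffunE mulr_sumr mulrz_suml; apply: eq_bigr => P _.
  rewrite mulr_sumr mulrz_suml [LHS]big_mkcond; apply: eq_bigr => Q _.
  by case: ifP => _; rewrite ?mulr0z // mulrzAr mulrA -mulrzA.
under eq_bigr do under eq_bigr do under eq_bigr do rewrite koszul_coef mulrzDr.
under eq_bigr do under eq_bigr do rewrite big_split.
under eq_bigr do rewrite big_split.
rewrite big_split /=; congr (_ + _); rewrite [RHS]ffunE; apply/esym.
- transitivity (\sum_j \sum_Q \sum_J T j (j |: J) Q *~ (ext_sign [set j] J *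
      (if J :|: Q == L then ext_sign J Q else 0))).
    rewrite [RHS]exchange_big [LHS](exchange_big_dep xpredT) //=.
    apply: eq_bigr => Q _; rewrite [RHS]exchange_big [LHS]big_mkcond /=.
    apply: eq_bigr => J _; case: ifP => _; last first.
      by rewrite big1 // => j _; rewrite mulr0 mulr0z.
    rewrite ffunE mulr_suml mulrz_suml; apply: eq_bigr => j _.
    by rewrite mulrzAl -mulrzA.
  apply: eq_bigr => j _; rewrite [RHS]exchange_big; apply: eq_bigr => Q _.
  by rewrite (koszul_reindex j (fun P => T j P Q)
                (fun J => if J :|: Q == L then ext_sign J Q else 0)).
- transitivity (\sum_j \sum_P \sum_M T j P (j |: M) *~ (ext_sign [set j] M *
      ((-1) ^+ #|P| * (if P :|: M == L then ext_sign P M else 0)))).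
    rewrite [RHS]exchange_big; apply: eq_bigr => P _ /=.
    rewrite [RHS]exchange_big [LHS]big_mkcond; apply: eq_bigr => M _ /=.
    case: ifP => _; last by rewrite big1 // => j _; rewrite !mulr0 mulr0z.
    rewrite koszul_sign // ffunE mulr_sumr mulrz_suml; apply: eq_bigr => j _.
    by rewrite mulrzAl mulrzAr mulrA -[f P * x j]xC -!mulrzA.
  apply: eq_bigr => j _; apply: eq_bigr => P _.
  by rewrite (koszul_reindex j (fun Q => T j P Q)
     (fun M => (-1) ^+ #|P| * (if P :|: M == L then ext_sign P M else 0))).
Qed.

Definition koszul_dga : dga :=
  @DGA K koszul_grading koszul_diff
    koszul_diff_deg koszul_diff_diff koszul_leibniz.

End KoszulComplex.

Section KoszulGenerators.
Variables (R : pzRingType) (D : grading R) (n : nat) (x : 'I_n -> R).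

Lemma koszul_gr_scalar p r : D p r -> koszul_gr D p (ext_scalar n r).
Proof.
move=> Dr J; rewrite ffunE; have [->|_] := eqVneq; last exact: shift_gr0.
by rewrite cards0 /shift_gr subn0.
Qed.

Lemma koszul_gr_gen (i : 'I_n) : koszul_gr D 1 (ext_gen R i).
Proof.
move=> J; rewrite ffunE; have [->|_] := eqVneq; last exact: shift_gr0.
by rewrite cards1 /shift_gr subnn; exact: gr1.
Qed.

Lemma koszul_diff_scalar r : koszul_diff x (ext_scalar n r) = 0.
Proof.
apply/ffunP => L; rewrite !ffunE big1 // => j _; rewrite ffunE.
by case: eqP => [/setP/(_ j)|_]; rewrite ?setU11 ?inE // mulr0 mul0rz.
Qed.

Lemma koszul_diff_gen (i : 'I_n) : koszul_diff x (ext_gen R i) = ext_scalar n (x i).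
Proof.
apply/ffunP => L; rewrite !ffunE (bigD1 i) //= [X in _ + X]big1 ?addr0 => [|j ji].
  rewrite ffunE; have [->|/set0Pn[l lL]] := eqVneq L set0.
    by rewrite setU0 eqxx mulr1 ext_sign0r.
  case: eqP => [/setP/(_ l)|_]; last by rewrite mulr0 mul0rz.
  rewrite !inE lL orbT => /esym/eqP El.
  by rewrite ext_sign_mem ?mulr0z // -El.
rewrite ffunE; case: eqP => [/setP/(_ j)|_]; last by rewrite mulr0 mul0rz.
by rewrite !inE eqxx (negPf ji).
Qed.

End KoszulGenerators.

(** * Stanley-Reisner rings and moment-angle complexes *)

Record simplicial_complex (n : nat) := SimplicialComplex {
  simplices :> {set {set 'I_n}};
  set0_simplex : set0 \in simplices;
  subset_simplex : forall sigma tau : {set 'I_n},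
    sigma \in simplices -> tau \subset sigma -> tau \in simplices }.

Section PolynomialGrading.
Variables (k : fieldType) (n : nat).
Local Notation S := {mpoly k[n]}.

(* each variable has degree 2 *)
Definition poly_gr (p : nat) (f : S) :=
  forall m, m \in msupp f -> (mdeg m).*2 = p.

Lemma poly_grP p f : poly_gr p f <-> forall m, (mdeg m).*2 != p -> f@_m = 0.
Proof.
split=> [Df m|Df m]; last first.
  by rewrite mcoeff_msupp => fm; apply/eqP; apply: contraNT fm => /Df ->.
by move=> ne; apply: memN_msupp_eq0; apply: contraNN ne => /Df ->.
Qed.

Fact poly_gr0 p : poly_gr p 0.
Proof. by apply/poly_grP => m _; rewrite mcoeff0. Qed.
Fact poly_grB p f g : poly_gr p f -> poly_gr p g -> poly_gr p (f - g).
Proof.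
move=> /poly_grP Df /poly_grP Dg; apply/poly_grP => m ne.
by rewrite mcoeffB Df // Dg // subrr.
Qed.
Fact poly_gr1 : poly_gr 0 1.
Proof.
apply/poly_grP => m ne; rewrite mcoeff1; case: eqP => // m0.
by rewrite m0 mdeg0 in ne.
Qed.
Fact poly_grM p q f g : poly_gr p f -> poly_gr q g -> poly_gr (p + q) (f * g).
Proof.
move=> Df Dg m /msuppM_le /allpairsP[[m1 m2] /= [/Df <- /Dg <- ->]].
by rewrite mdegD doubleD.
Qed.
Fact poly_gr_sum f : exists N (c : nat -> S),
  (forall p, poly_gr p (c p)) /\ f = \sum_(p < N) c p.
Proof.
pose c p := \sum_(m <- msupp f | (mdeg m).*2 == p) f@_m *: 'X_[m] : S.
exists (msize f).*2, c; split=> [p|].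
  apply/poly_grP => m ne; rewrite raddf_sum big1_seq //= => m' /andP[/eqP Em' _].
  rewrite mcoeffZ mcoeffX; case: eqP => [Em|]; last by rewrite mulr0.
  by rewrite -Em Em' eqxx in ne.
rewrite [LHS]mpolyE (exchange_big_dep xpredT) //= [LHS]big_seq [RHS]big_seq.
apply: eq_bigr => m mf; have lt : ((mdeg m).*2 < (msize f).*2)%N.
  by rewrite ltn_double; exact: msize_mdeg_lt.
by rewrite (big_pred1 (Ordinal lt)) // => p; rewrite /= eq_sym.
Qed.
Fact poly_gr_direct N (c : nat -> S) : (forall p, poly_gr p (c p)) ->
  \sum_(p < N) c p = 0 -> forall p, (p < N)%N -> c p = 0.
Proof.
move=> Dc c0 p ltpN; apply/mpolyP => m; rewrite mcoeff0.
have Dc0 q : (mdeg m).*2 != q -> (c q)@_m = 0 by move/(poly_grP q (c q)).1: (Dc q); apply.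
have [Ep|ne] := eqVneq (mdeg m).*2 p; last exact: Dc0.
have := congr1 (mcoeff m) c0; rewrite mcoeff0 raddf_sum (bigD1 (Ordinal ltpN)) //=.
rewrite big1 ?addr0 // => q ne; apply: Dc0; rewrite Ep eq_sym.
by apply: contraNneq ne => Eq; apply/eqP/val_inj.
Qed.

Definition poly_grading : grading S :=
  Grading poly_gr0 poly_grB poly_gr1 poly_grM poly_gr_sum poly_gr_direct.

Lemma poly_gr_var (i : 'I_n) : poly_gr 2 'X_i.
Proof. by move=> m; rewrite msuppX inE => /eqP ->; rewrite mdeg1. Qed.

End PolynomialGrading.

Section CochainAlgebra.
Variables (k : fieldType) (n : nat) (K : simplicial_complex n).
Local Notation S := {mpoly k[n]}.

Definition sr_gens (f : S) :=
  exists2 sigma : {set 'I_n}, sigma \notin K & f = \prod_(i in sigma) 'X_i.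

Definition sr_ideal : ideal S := gen_ideal sr_gens.

Fact sr_gens_hom f : sr_gens f -> exists p, poly_grading k n p f.
Proof.
move=> [sigma _ ->]; apply: (big_ind (fun f : S => exists p, poly_grading k n p f)).
- by exists 0%N; exact: gr1.
- by move=> g h [p Dg] [q Dh]; exists (p + q)%N; exact: grM.
- by move=> i _; exists 2%N; exact: poly_gr_var.
Qed.

Definition face_ring : pzRingType := quotient_ring sr_ideal.
Definition face_grading : grading face_ring := quot_grading sr_gens_hom.
Definition face_var (i : 'I_n) : face_ring := quot_pi sr_ideal 'X_i.

Fact face_even p a : odd p -> face_grading p a -> a = 0.
Proof.
move=> odd_p [f Df ->]; rewrite (_ : f = 0) ?raddf0 //; apply/mpolyP => m.
rewrite mcoeff0; apply: (poly_grP p f).1 => //.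
by apply: contraTneq odd_p => <-; rewrite odd_double.
Qed.
Fact face_varD i : face_grading 2 (face_var i).
Proof. by exists 'X_i => //; exact: poly_gr_var. Qed.
Fact face_varC i a : face_var i * a = a * face_var i.
Proof. by have [f ->] := quot_piW a; rewrite -!rmorphM mulrC. Qed.

(* the Koszul complex S/I_K (x) E *)
Definition face_koszul : dga := koszul_dga face_even face_varD face_varC.

Definition x_ (i : 'I_n) : face_koszul := ext_scalar n (face_var i).
Definition u_ (i : 'I_n) : face_koszul := ext_gen face_ring i.

Definition cochain_gens (f : face_koszul) :=
  exists i, f = x_ i ^+ 2 \/ f = x_ i * u_ i.

Fact x_deg i : deg face_koszul 2 (x_ i).
Proof. by apply: koszul_gr_scalar; exact: face_varD. Qed.
Fact u_deg i : deg face_koszul 1 (u_ i).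
Proof. exact: koszul_gr_gen. Qed.
Fact diff_x i : diff face_koszul (x_ i) = 0.
Proof. exact: koszul_diff_scalar. Qed.
Fact diff_u i : diff face_koszul (u_ i) = x_ i.
Proof. exact: koszul_diff_gen. Qed.

Fact cochain_gens_hom f : cochain_gens f -> exists p, deg face_koszul p f.
Proof.
move=> [i [->|->]]; [exists (2 + 2)%N; rewrite expr2|exists (2 + 1)%N].
  by apply: grM; exact: x_deg.
by apply: grM; [exact: x_deg|exact: u_deg].
Qed.

Fact cochain_gens_diff f :
  cochain_gens f -> gen_ideal cochain_gens (diff face_koszul f).
Proof.
move=> [i [->|->]].
  rewrite expr2 (diff_leibniz _ (x_deg i)) diff_x mul0r mulr0 addr0.
  exact: ideal0.
rewrite (diff_leibniz _ (x_deg i)) diff_x mul0r add0r sqrrN expr1n mul1r diff_u.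
by apply: gen_ideal_gen; exists i; left; rewrite expr2.
Qed.

(* the cellular cochain algebra of the moment-angle complex Z_K, whose cohomology
   is H^*(Z_K, k) *)
Definition cochain_algebra : dga := quot_dga cochain_gens_hom cochain_gens_diff.

End CochainAlgebra.

(* the variable x_i for i = 1, ..., 8 *)
Definition var8 (k : fieldType) (i : nat) : {mpoly k[8]} := 'X_(inord i.-1).

(* Main.v *)
From HB Require Import structures.
Require Import Defs.
From mathcomp Require Import all_boot all_order all_algebra generic_quotient mpoly.
From mathcomp Require Import ring.

Set Implicit Arguments.
Unset Strict Implicit.
Unset Printing Implicit Defensive.

Import GRing.Theory.
Local Open Scope ring_scope.

(** Take the Massey product of the classes of x_1 u_2, x_3 x_4 x_5 u_6 and x_7 u_8.
    The product of the first two cochains is zero because 1345 is not a face; that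
    of the last two is the coboundary of x_3 x_5 x_7 u_4 u_6 u_8, because 3567 and
    78 are not faces. So the Massey product contains the class of
    x_1 x_3 x_5 x_7 u_2 u_4 u_6 u_8 ([massey_representative]).

    The argument for indecomposability is topological. The part of the cochain
    algebra of multidegree 12345678 computes the reduced cohomology of K, shifted,
    and the class above is a 3-cocycle supported on the tetrahedron 1357. Without
    the nonfaces 1345 and 3567 the complex would be the 4-sphere
    S^0(1,2) * S^0(7,8) * boundary of 3456, so K is this sphere with the open stars
    of 1345 and 3567 removed. The boundaries of the two holes are homologous
    3-cycles of K, and both contain 1357 once; evaluation on the first one is the
    functional [cycle_functional]. It vanishes on coboundaries and takes the value 1
    on the class above.

    It also vanishes on every product of cocycles of positive degree
    ([cycle_functionalM]). The part of such a product that comes from multidegrees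
    J and ~ J, both nonempty, is pulled back from the join of the restrictions of K
    to J and ~ J, and the cycle bounds in this join. Indeed J separates two elements
    of one of the sets 1345, 3567, 78, 12 ([nontrivial_split]): in the first two
    cases the corresponding hole is filled in the join; in the others the cycle,
    which is the suspension of the boundary of 1345 with apexes 7 and 8 and is
    homologous to the suspension of the boundary of 3567 with apexes 1 and 2, bounds
    the join with the edge between the apexes.

    Since the indeterminacy of the Massey product is made of products
    ([massey_indeterminacy]), the functional takes the value 1 on the whole Massey
    product, while it vanishes on decomposable classes
    ([indecomposable_by_functional]). *)

(** * Massey products and linear functionals *)

Section Representatives.
Variable A : dga.
Local Notation d := (diff A).
Implicit Types (a b c : A) (alpha beta gamma omega : cohomology A).

Lemma represents_exists a : d a = 0 -> exists alpha, represents a alpha.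
Proof.
move=> da; have Za : a \in @cocycle_pred A by apply/eqP.
by exists (quot_pi (coboundary A) (Cocycle Za)); exists (Cocycle Za).
Qed.

Lemma represents_cocycle a alpha : represents a alpha -> d a = 0.
Proof. by move=> [z <- _]; exact: cocycleE. Qed.

Lemma representsD a b alpha beta :
  represents a alpha -> represents b beta -> represents (a + b) (alpha + beta).
Proof. by move=> [z <- <-] [w <- <-]; exists (z + w) => //; rewrite raddfD. Qed.

Lemma representsM a b alpha beta :
  represents a alpha -> represents b beta -> represents (a * b) (alpha * beta).
Proof. by move=> [z <- <-] [w <- <-]; exists (z * w) => //; rewrite rmorphM. Qed.

Lemma represents_diff a a' alpha : represents a alpha -> represents a' alpha ->
  exists b, d b = a - a'.
Proof.
by move=> [z <- <-] [w <- Ew]; have /quot_piP[b] := esym Ew; exists b.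
Qed.

Lemma represents_eq a a' b alpha alpha' :
  represents a alpha -> represents a' alpha' -> d b = a - a' -> alpha = alpha'.
Proof. by move=> [z <- <-] [w <- <-] db; apply/quot_piP; exists b. Qed.

Lemma represents_eq0 a b alpha : represents a alpha -> d b = a -> alpha = 0.
Proof.
move=> Ra db; apply: (represents_eq (b := b) Ra (a' := 0)); last by rewrite db subr0.
by exists 0; rewrite ?raddf0.
Qed.

(** An element of H^{>0} need not be homogeneous, so an additive property of
    cocycles is checked on the homogeneous ones. *)
Lemma coh_pos_represented (P : A -> Prop) alpha : P 0 ->
  (forall a b, P a -> P b -> P (a + b)) ->
  (forall p a, deg A p.+1 a -> d a = 0 -> P a) ->
  coh_pos alpha -> exists2 a, represents a alpha & P a.
Proof.
move=> P0 PD Phom [N [c [Dc ->]]].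
apply: (big_ind (fun x => exists2 a, represents a x & P a)) => [|x y [a Ra Pa]|p _].
- by exists 0 => //; exists 0; rewrite ?raddf0.
- by move=> [b Rb Pb]; exists (a + b); [exact: representsD|exact: PD].
by have [a Da Ra] := Dc p; exists a => //; apply: Phom Da (represents_cocycle Ra).
Qed.

(** The component of degree p of any primitive is again a primitive. *)
Lemma homogeneous_primitive p b a : d b = a -> deg A p.+1 a ->
  exists2 c, deg A p c & d c = a.
Proof.
move=> db Da; have [N [c [Dc Ec]]] := gr_sum (deg A) b.
pose e q := if q is q'.+1 then d (c q') else 0.
have De q : deg A q (e q) by case: q => [|q]; [exact: gr0|exact: diff_deg].
pose f (q : nat) := if q == p.+1 then a else 0.
have Df q : deg A q (f q) by rewrite /f; case: eqP => [->|_] //; exact: gr0.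
have Eef : \sum_(q < N.+1) e q = \sum_(q < p.+2) f q.
  rewrite big_ord_recl add0r [RHS]big_ord_recr /= [X in _ = X + _]big1 => [|q _].
    by rewrite add0r /f eqxx -db Ec raddf_sum.
  by rewrite /f; case: eqP => // Eq; have := ltn_ord q; rewrite Eq ltnn.
have := gr_uniq De Df Eef p.+1; rewrite ltnS leqnn /f eqxx => Ea.
exists (if (p < N)%N then c p else 0); first by case: ifP => _ //; exact: gr0.
by rewrite -Ea; case: ifP => _ //; rewrite raddf0.
Qed.

End Representatives.


Section MasseyIndeterminacy.
Variable A : dga.
Local Notation d := (diff A).

Lemma massey_defect_sum (V : zmodType) (X Xb P C U Y T W E : V) :
  (X + Xb + P + C + U) - (Y + C + T + W + E) =
  (X - Y) + (U - W) + ((Xb - T) + (P - E)).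
Proof.
rewrite !opprD !addrA [LHS](ACl (1*6*5*9*2*8*3*10*(4*7))) /=.
by rewrite subrr addr0.
Qed.

Lemma telescope3 (V : zmodType) (X Y Z : V) :
  X + (- Z - (X - Y) - (Y - Z)) = 0.
Proof.
by rewrite -!opprD -addrA [X - Y + _]addrA subrK [Z + _]addrC subrK subrr.
Qed.

Lemma sign_comm p (a : A) : a * (-1) ^+ p = (-1) ^+ p * a.
Proof. by rewrite -signr_odd; case: (odd p); rewrite ?mulr1 ?mul1r ?mulrN1 ?mulN1r. Qed.

Lemma deg_sign p : deg A 0 ((-1) ^+ p : A).
Proof.
by rewrite -signr_odd; case: (odd p); [apply: grN|]; exact: gr1.
Qed.

Lemma diff_sign p (a : A) : d ((-1) ^+ p * a) = (-1) ^+ p * d a.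
Proof. by rewrite -signr_odd; case: (odd p); rewrite ?mul1r // !mulN1r raddfN. Qed.

(** If the first product already vanishes on cochains, then its primitive can be
    taken to be 0. *)
Lemma massey_zero_product p q r (alpha beta gamma : cohomology A) a1 a2 a3 y :
  deg A p.+1 a1 -> deg A q.+1 a2 -> deg A r.+1 a3 ->
  represents a1 alpha -> represents a2 beta -> represents a3 gamma ->
  a1 * a2 = 0 -> deg A (q + r).+1 y -> d y = a2 * a3 ->
  exists2 omega, massey p.+1 q.+1 r.+1 alpha beta gamma omega &
    represents ((-1) ^+ p * a1 * y) omega.
Proof.
move=> D1 D2 D3 R1 R2 R3 a12 Dy dy.
have dm : d ((-1) ^+ p * a1 * y) = 0.
  rewrite -mulrA diff_sign (diff_leibniz _ D1) (represents_cocycle R1) mul0r add0r.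
  by rewrite dy -[_ * a1 * _]mulrA [a1 * (a2 * a3)]mulrA a12 mul0r !mulr0.
have [omega Rm] := represents_exists dm; exists omega => //.
exists a1, a2, a3, 0, y; split=> //.
  by split; rewrite ?raddf0 ?a12 //= ?addSn ?addnS //; exact: gr0.
by rewrite mul0r sub0r exprS mulN1r !mulNr opprK.
Qed.

(** Two choices of representatives differ by coboundaries of [b1], [b2], [b3]. The
    change of representatives forces the changes b1 a2' +- a1 b2 of [x] and
    b2 a3' +- a2 b3 of [y]; what remains of the differences of the
    primitives are the cocycles [u] and [w], which account for the two products. *)
Lemma massey_indeterminacy p q r (alpha beta gamma omega omega' : cohomology A) :
  massey p.+1 q.+1 r.+1 alpha beta gamma omega ->
  massey p.+1 q.+1 r.+1 alpha beta gamma omega' ->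
  exists u v, [/\ coh (p + q).+1 u, coh (q + r).+1 v
                & omega' = omega + u * gamma + alpha * v].
Proof.
move=> [a1 [a2 [a3 [x [y]]]]] [[D1 R1] [D2 R2] [D3 R3] [Dx dx Dy dy] Rm].
move=> [a1' [a2' [a3' [x' [y']]]]] [[D1' R1'] [D2' R2'] [D3' R3'] [Dx' dx' Dy' dy'] Rm'].
move: Dx Dx' Dy Dy'; rewrite /deg_pred !addSn !addnS => Dx Dx' Dy Dy'.
have [[c1 dc1] [c2 dc2] [c3 dc3]] := And3 (represents_diff R1' R1)
  (represents_diff R2' R2) (represents_diff R3' R3).
have [b1 Db1 db1] := homogeneous_primitive dc1 (grB D1' D1).
have [b2 Db2 db2] := homogeneous_primitive dc2 (grB D2' D2).
have [b3 Db3 db3] := homogeneous_primitive dc3 (grB D3' D3).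
have [[da1 da2 da3] [da1' da2' da3']] := conj
  (And3 (represents_cocycle R1) (represents_cocycle R2) (represents_cocycle R3))
  (And3 (represents_cocycle R1') (represents_cocycle R2') (represents_cocycle R3')).
pose s : A := (-1) ^+ p.+1; pose t : A := (-1) ^+ q.+1.
have ss : s * s = 1 by rewrite /s -expr2 sqrr_sign.
have tt : t * t = 1 by rewrite /t -expr2 sqrr_sign.
pose u := x' - (x + b1 * a2' + s * (a1 * b2)).
pose w := y' - (y + b2 * a3' + t * (a2 * b3)).
have du : d u = 0.
  rewrite raddfB !raddfD /= dx dx' (diff_leibniz _ Db1) da2' mulr0 addr0.
  rewrite diff_sign (diff_leibniz _ D1) da1 mul0r add0r -/s -mulrA mulrA ss mul1r.
  by rewrite db1 db2 mulrBl mulrBr telescope3.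
have dw : d w = 0.
  rewrite raddfB !raddfD /= dy dy' (diff_leibniz _ Db2) da3' mulr0 addr0.
  rewrite diff_sign (diff_leibniz _ D2) da2 mul0r add0r -/t -mulrA mulrA tt mul1r.
  by rewrite db2 db3 mulrBl mulrBr telescope3.
have Du : deg A (p + q).+1 u.
  apply: grB => //; apply: grD; first apply: grD => //.
    by rewrite -addnS; exact: grM.
  by rewrite -[(p + q).+1]/(0 + _)%N; apply: grM; [exact: deg_sign|rewrite -addSn; exact: grM].
have Dw : deg A (q + r).+1 w.
  apply: grB => //; apply: grD; first apply: grD => //.
    by rewrite -addnS; exact: grM.
  by rewrite -[(q + r).+1]/(0 + _)%N; apply: grM; [exact: deg_sign|rewrite -addSn; exact: grM].
have sdw : d (- (s * w)) = 0 by rewrite raddfN diff_sign dw mulr0 oppr0.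
have [[mu Rmu] [nu Rnu]] := (represents_exists du, represents_exists (sdw : d (- (s * w)) = 0)).
exists mu, nu; split; [by exists u|exists (- (s * w)) => //|].
  apply: grN; rewrite -[(q + r).+1]/(0 + _)%N.
  by apply: grM => //; exact: deg_sign.
pose s' : A := (-1) ^+ (p + q).+1.
have Es' : s' = - (s * t) by rewrite /s' /s /t -exprD addSn addnS [in RHS]exprS mulN1r opprK.
have s's' : s' * s' = 1 by rewrite /s' -expr2 sqrr_sign.
have Rsum := representsD (representsD Rm (representsM Rmu R3')) (representsM R1 Rnu).
(* The two terms are the coboundaries left over from varying a3 and a1. *)
apply: (represents_eq (b := s' * (x * b3) - s * (b1 * y')) Rm' Rsum).
rewrite raddfB /= !diff_sign (diff_leibniz _ Dx) (diff_leibniz _ Db1) dx dy'.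
have -> : x' = x + b1 * a2' + s * (a1 * b2) + u by rewrite /u subrKC.
have Ey' : a1' * y' = a1 * y + a1 * (b2 * a3') + t * (a1 * (a2 * b3)) + a1 * w +
    d b1 * y'.
  rewrite db1 mulrBl -[LHS](subrKC (a1 * y')); congr (_ + _).
  have {1}-> : y' = y + b2 * a3' + t * (a2 * b3) + w by rewrite /w subrKC.
  by rewrite !mulrDr [a1 * (t * _)]mulrA sign_comm -mulrA.
rewrite -/s -[s * a1' * y']mulrA Ey' -[s * a1 * y]mulrA.
have Ex : (x + b1 * a2' + s * (a1 * b2) + u) * a3' =
    x * a3 + x * d b3 + b1 * (a2' * a3') + s * (a1 * (b2 * a3')) + u * a3'.
  by rewrite !mulrDl -!mulrA db3 mulrBr subrKC.
have Es p' (c e f g h : A) : (-1) ^+ p' * (c + e + t * f + g + h) =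
    (-1) ^+ p' * c + (-1) ^+ p' * e + (-1) ^+ p' * t * f + (-1) ^+ p' * g
      + (-1) ^+ p' * h.
  by rewrite !mulrDr mulrA.
rewrite Ex Es massey_defect_sum -/s mulrN [a1 * (s * w)]mulrA [a1 * s]sign_comm -/s.
rewrite -[s * a1 * w]mulrA -[x * a3 - _ + _ - _]addrA addrAC subrr add0r; congr (_ + _).
  rewrite -/s' mulrDr [s' * (s' * x * _)]mulrA [s' * (s' * x)]mulrA s's' mul1r.
  by rewrite addrC Es' mulNr -[a1 * a2 * b3]mulrA.
have -> : (-1) ^+ p = - s by rewrite /s exprS mulN1r opprK.
by rewrite mulrDr opprD addrC !mulNr mulrN opprK
   [s * (s * b1 * _)]mulrA [s * (s * b1)]mulrA ss mul1r.
Qed.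

End MasseyIndeterminacy.

Section Functional.
Variables (A : dga) (V : zmodType) (phi : {additive A -> V}).
Local Notation d := (diff A).

(** A functional that kills the coboundaries and the products of cocycles of
    positive degree is constant on a Massey product, whose indeterminacy consists
    of sums of such products, and it is zero on decomposable classes. *)
Lemma indecomposable_by_functional p q r (alpha beta gamma omega : cohomology A) a :
  (forall b, phi (d b) = 0) ->
  (forall i j z w, deg A i.+1 z -> deg A j.+1 w -> d z = 0 -> d w = 0 ->
     phi (z * w) = 0) ->
  massey p.+1 q.+1 r.+1 alpha beta gamma omega -> represents a omega ->
  phi a != 0 -> ~ decomposable (massey p.+1 q.+1 r.+1 alpha beta gamma).
Proof.
move=> phid phiM Momega Ra /eqP phia0 [lambda [nu [lpos npos Mln]]]; apply: phia0.
have [u [v [[z Dz Rz] [w Dw Rw] Eln]]] := massey_indeterminacy Momega Mln.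
have [a1 [_ [a3 [_ [_ [[D1 R1] _ [D3 R3] _ _]]]]]] := Momega.
have [l Rl Pl] : exists2 l, represents l lambda &
    forall j n, deg A j.+1 n -> d n = 0 -> phi (l * n) = 0.
  apply: coh_pos_represented lpos => [j n _ _|b c Pb Pc j n Dn dn|i b Db db j n Dn dn].
  - by rewrite mul0r raddf0.
  - by rewrite mulrDl raddfD /= (Pb j) // (Pc j) // addr0.
  - exact: phiM Db Dn db dn.
have [n Rn Pn] : exists2 n, represents n nu & phi (l * n) = 0.
  apply: coh_pos_represented npos => [|b c Pb Pc|j n Dn dn]; last exact: Pl Dn dn.
    by rewrite mulr0 raddf0.
  by rewrite mulrDr raddfD /= Pb Pc addr0.
have Rsum := representsD (representsD Ra (representsM Rz R3)) (representsM R1 Rw).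
rewrite -Eln in Rsum; have [b db] := represents_diff Rsum (representsM Rl Rn).
have := phid b; rewrite db raddfB !raddfD /= Pn subr0.
rewrite (phiM _ _ _ _ Dz D3 (represents_cocycle Rz) (represents_cocycle R3)).
by rewrite (phiM _ _ _ _ D1 Dw (represents_cocycle R1) (represents_cocycle Rw)) !addr0.
Qed.

End Functional.

(** * Coefficients of squarefree monomials *)

Section SquarefreeMonomials.
Variables (k : fieldType) (n : nat).
Implicit Types (s t : {set 'I_n}) (f g : {mpoly k[n]}).

Definition mset s : 'X_{1..n} := [multinom (i \in s : nat) | i < n].

Lemma prod_vars s : \prod_(i in s) 'X_i = 'X_[mset s] :> {mpoly k[n]}.
Proof.
rewrite mpolyXE_id big_mkcond /=; apply: eq_bigr => i _.
by rewrite mnmE; case: (i \in s); rewrite ?expr1 ?expr0.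
Qed.

Lemma mset_inj : injective mset.
Proof.
move=> s t /mnmP E; apply/setP => i; have := E i.
by rewrite !mnmE; do 2!case: (i \in _).
Qed.

Lemma msetU s t : [disjoint s & t] -> mset (s :|: t) = (mset s + mset t)%MM.
Proof.
move=> /pred0P dst; apply/mnmP => i; rewrite mnmDE !mnmE inE.
by have := dst i => /=; do 2!case: (i \in _).
Qed.

Lemma mset1 i : mset [set i] = U_(i)%MM.
Proof. by apply/mnmP => j; rewrite mnm1E mnmE inE eq_sym. Qed.

Lemma mset0 : mset set0 = 0%MM.
Proof. by apply/mnmP => j; rewrite mnmE inE mnmE. Qed.

Lemma mdeg_mset s : mdeg (mset s) = #|s|.
Proof.
rewrite mdegE -sum1_card [RHS]big_mkcond; apply: eq_bigr => i _.
by rewrite mnmE; case: ifP.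
Qed.

Lemma mset_splitting s (m1 m2 : 'X_{1..n}) : (m1 + m2)%MM = mset s ->
  exists2 t : {set 'I_n}, t \subset s & m1 = mset t /\ m2 = mset (s :\: t).
Proof.
move=> /mnmP E; exists [set i | m1 i != 0%N].
  apply/subsetP => i; rewrite inE; have := E i.
  by rewrite mnmDE mnmE; case: (i \in s); case: (m1 i).
split; apply/mnmP => i; have := E i; rewrite mnmDE !mnmE !inE;
by case: (i \in s); case: (m1 i) => [|[|?]]; case: (m2 i) => [|[|?]].
Qed.

Lemma mcoeffM_mset s f g :
  (f * g)@_(mset s) = \sum_(t : {set 'I_n} | t \subset s) f@_(mset t) * g@_(mset (s :\: t)).
Proof.
rewrite {1}[f]mpolyE {1}[g]mpolyE mulr_suml raddf_sum /=.
under [RHS]eq_bigr do rewrite {1}[f]mpolyE {1}[g]mpolyE !raddf_sum mulr_suml /=.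
rewrite [RHS]exchange_big; apply: eq_bigr => m1 _.
under [RHS]eq_bigr do rewrite mulr_sumr.
rewrite mulr_sumr raddf_sum [RHS]exchange_big; apply: eq_bigr => m2 _ /=.
rewrite -scalerAl -scalerAr -mpolyXD !mcoeffZ mcoeffX.
under [RHS]eq_bigr do rewrite !mcoeffZ !mcoeffX mulrACA -natrM mulnb.
rewrite mulrA -mulr_sumr; congr (_ * _).
have [E|ne] := eqVneq (m1 + m2)%MM (mset s); last first.
  rewrite big1 // => t ts; case: eqP => // E1; case: eqP => // E2.
  case/eqP: ne; rewrite E1 E2 -msetU ?setDE; last first.
    by rewrite -setI_eq0 setICA setICr setI0.
  by rewrite setUIr setUCr setIT (setUidPr ts).
have [t ts [-> ->]] := mset_splitting E.
rewrite (bigD1 t) //= !eqxx big1 ?addr0 // => t' /andP[_ ne].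
by rewrite (inj_eq mset_inj) eq_sym (negPf ne).
Qed.

Lemma gen_ideal_mcoeff0 (G : {mpoly k[n]} -> Prop) m0 :
  (forall g m, G g -> m \in msupp g -> ~~ (m <= m0)%MM) ->
  forall f, gen_ideal G f -> f@_m0 = 0.
Proof.
move=> HG f; elim=> [|a g b c Gg _ IH]; first exact: mcoeff0.
rewrite mcoeffD IH addr0; apply: memN_msupp_eq0; apply/negP.
move=> /msuppM_le/allpairsP[[m1 m2] /= [/msuppM_le/allpairsP[[m3 m4] /= [_ m4g ->]] _ E]].
have /negP := HG _ _ Gg m4g; apply; apply/mnm_lepP => i.
by rewrite E !mnmDE addnAC leq_addl.
Qed.

End SquarefreeMonomials.

Section FaceCoefficients.
Variables (k : fieldType) (n : nat) (K : simplicial_complex n).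
Implicit Types (s t J : {set 'I_n}) (r : face_ring k K).

Lemma sr_ideal_mcoeff0 s f : s \in K -> sr_ideal k K f -> f@_(mset s) = 0.
Proof.
move=> sK; apply: gen_ideal_mcoeff0 => _ m [t tK ->].
rewrite prod_vars msuppX inE => /eqP ->; apply: contraNN tK => /mnm_lepP le.
apply: subset_simplex sK _; apply/subsetP => i it.
by have := le i; rewrite !mnmE it; case: (i \in s).
Qed.

(** The coefficient of a squarefree monomial of a face does not depend on the
    representative; it is set to zero on non-faces so as to be additive. *)
Definition face_coef s r : k := if s \in K then (repr r)@_(mset s) else 0.

Lemma face_coefE s f :
  face_coef s (quot_pi _ f) = if s \in K then f@_(mset s) else 0.
Proof.
rewrite /face_coef; case: ifP => // sK; apply/eqP; rewrite -subr_eq0 -mcoeffB.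
by apply/eqP; apply: sr_ideal_mcoeff0 sK _; exact: quot_repr.
Qed.

Fact face_coef_zmod s : zmod_morphism (face_coef s).
Proof.
move=> q r; have [[f ->] [g ->]] := (quot_piW q, quot_piW r).
by rewrite -raddfB !face_coefE; case: ifP => _; rewrite ?mcoeffB ?subr0.
Qed.

HB.instance Definition _ s :=
  GRing.isZmodMorphism.Build (face_ring k K) k (face_coef s) (face_coef_zmod s).

Lemma face_coefM s q r : s \in K ->
  face_coef s (q * r) = \sum_(t : {set 'I_n} | t \subset s) face_coef t q * face_coef (s :\: t) r.
Proof.
move=> sK; have [[f ->] [g ->]] := (quot_piW q, quot_piW r).
rewrite -rmorphM face_coefE sK mcoeffM_mset; apply: eq_bigr => t ts.
by rewrite !face_coefE !(subset_simplex sK) ?subsetDl.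
Qed.

Lemma face_coef_var s i : s \in K -> face_coef s (face_var k K i) = (s == [set i])%:R.
Proof. by move=> sK; rewrite face_coefE sK mcoeffX -mset1 (inj_eq (@mset_inj _)) eq_sym. Qed.

Lemma face_coef1 s : s \in K -> face_coef s 1 = (s == set0)%:R.
Proof.
move=> sK; rewrite -(rmorph1 (quot_pi (sr_ideal k K))) face_coefE sK.
by rewrite mcoeff1 -mset0 (inj_eq (@mset_inj _)).
Qed.

Lemma face_coef_varM s i r : s \in K ->
  face_coef s (face_var k K i * r) = if i \in s then face_coef (s :\ i) r else 0.
Proof.
move=> sK; rewrite face_coefM //; case: ifP => [si|/negP si].
  rewrite (bigD1 [set i]) ?sub1set //= face_coef_var ?eqxx ?mul1r; last first.
    by apply: subset_simplex sK _; rewrite sub1set.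
  rewrite big1 ?addr0 // => t /andP[ts ne].
  by rewrite face_coef_var ?(negPf ne) ?mul0r // (subset_simplex sK).
rewrite big1 // => t ts; rewrite face_coef_var ?(subset_simplex sK) //.
by case: eqP ts => [->|]; rewrite ?mul0r // sub1set.
Qed.

Lemma face_coef_pos p r : face_grading k K p.+1 r -> face_coef set0 r = 0.
Proof.
move=> [f Df ->]; rewrite face_coefE set0_simplex.
by apply: (poly_grP p.+1 f).1 => //; rewrite mset0 mdeg0.
Qed.

End FaceCoefficients.

(** * Coefficients in the cellular cochain algebra *)

Lemma ext_mulE (R : pzRingType) n (f g : exterior R n) t :
  (f * g) t = \sum_(J : {set 'I_n} | J \subset t) (f J * g (t :\: J)) *~ ext_sign J (t :\: J).
Proof.
rewrite [LHS]ffunE [RHS]big_mkcond; apply: eq_bigr => J _; case: ifP => Jt.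
  rewrite (bigD1 (t :\: J)) /=; last by rewrite setDE setUIr setUCr setIT (setUidPr Jt).
  rewrite [X in _ + X]big1 ?addr0 // => M /andP[/eqP Et ne]; rewrite /ext_sign.
  case: ifP => [dJM|_]; last exact: mulr0z.
  by case/eqP: ne; rewrite -Et setDUl setDv set0U; apply/esym/setDidPl; rewrite disjoint_sym.
by rewrite big1 // => M /eqP Et; rewrite -Et subsetUl in Jt.
Qed.

Section CochainCoefficients.
Variables (k : fieldType) (n : nat) (K : simplicial_complex n).
Local Notation A := (cochain_algebra k K).
Implicit Types (s t J : {set 'I_n}) (g h : face_koszul k K) (a b : A).

Lemma ext_coefM s t g h : s \in K ->
  face_coef s ((g * h) t) =
  \sum_(s1 : {set 'I_n} | s1 \subset s) \sum_(t1 : {set 'I_n} | t1 \subset t)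
    (face_coef s1 (g t1) * face_coef (s :\: s1) (h (t :\: t1)))
      *~ ext_sign t1 (t :\: t1).
Proof.
move=> sK; rewrite ext_mulE raddf_sum exchange_big; apply: eq_bigr => t1 _.
by rewrite raddfMz /= face_coefM // mulrz_suml.
Qed.

Definition disjoint_coef0 g :=
  forall s t, s \in K -> [disjoint s & t] -> face_coef s (g t) = 0.

Lemma disjointSS s t s1 t1 :
  s1 \subset s -> t1 \subset t -> [disjoint s & t] -> [disjoint s1 & t1].
Proof. by move=> ss tt dst; apply: disjointWl ss _; apply: disjointWr tt _. Qed.

Lemma disjoint_coef0Ml g h : disjoint_coef0 h -> disjoint_coef0 (g * h).
Proof.
move=> h0 s t sK dst; rewrite ext_coefM // big1 // => s1 ss; rewrite big1 // => t1 tt.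
rewrite h0 ?mulr0 ?mul0rz //; first exact: subset_simplex sK (subsetDl _ _).
exact: disjointSS (subsetDl _ _) (subsetDl _ _) dst.
Qed.

Lemma disjoint_coef0Mr g h : disjoint_coef0 g -> disjoint_coef0 (g * h).
Proof.
move=> g0 s t sK dst; rewrite ext_coefM // big1 // => s1 ss; rewrite big1 // => t1 tt.
by rewrite g0 ?mul0r ?mul0rz //; [exact: subset_simplex sK ss|exact: disjointSS ss tt dst].
Qed.

Lemma ext_coef_x s t i : s \in K ->
  face_coef s (x_ k K i t) = ((t == set0) && (s == [set i]))%:R.
Proof. by move=> sK; rewrite ffunE; case: eqP => _; rewrite ?raddf0 // face_coef_var. Qed.

Lemma ext_coef_u s t i : s \in K ->
  face_coef s (u_ k K i t) = ((t == [set i]) && (s == set0))%:R.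
Proof.
move=> sK; rewrite ffunE; case: eqP => _; last exact: raddf0.
exact: face_coef1.
Qed.

(** Every monomial of a product of [x_i] and either [x_i] or [u_i] uses the index
    [i] twice, so none of them is of the form x_s u_t with s and t disjoint. *)
Lemma cochain_gens_coef0 g : cochain_gens g -> disjoint_coef0 g.
Proof.
move=> [i [->|->]] s t sK dst; rewrite ?expr2 ext_coefM //.
all: rewrite big1 // => s1 ss; rewrite big1 // => t1 tt.
all: have [s1K s2K] := (subset_simplex sK ss, subset_simplex sK (subsetDl s s1)).
  rewrite !ext_coef_x //; case: (s1 =P [set i]) => [->|]; last by rewrite andbF mul0r mul0rz.
  case: (s :\: _ =P _) => [/setP/(_ i)|]; last by rewrite andbF mulr0 mul0rz.
  by rewrite !inE eqxx.
rewrite ext_coef_x // ext_coef_u //.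
case: (s1 =P [set i]) => [Es|]; last by rewrite andbF mul0r mul0rz.
case: (t :\: t1 =P [set i]) => [Et|]; last by rewrite mulr0 mul0rz.
have := disjointSS ss (subsetDl t t1) dst.
by rewrite Es Et disjoints1 inE eqxx.
Qed.

Lemma cochain_ideal_coef0 f : gen_ideal (@cochain_gens k n K) f -> disjoint_coef0 f.
Proof.
elim=> [|a g b c Gg _ IH] s t sK dst; first by rewrite ffunE raddf0.
rewrite ffunE raddfD /= IH // addr0; apply: disjoint_coef0Mr => //.
exact/disjoint_coef0Ml/cochain_gens_coef0.
Qed.

(** The coefficient of x_s u_(J \ s), a monomial of multidegree J when s is a
    subset of J. *)
Definition xu_coef J s a : k := face_coef s (repr a (J :\: s)).

Lemma xu_coefE J s g : xu_coef J s (quot_pi _ g) = face_coef s (g (J :\: s)).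
Proof.
have [sK|sK] := boolP (s \in K); last by rewrite /xu_coef /face_coef (negPf sK).
apply/eqP; rewrite -subr_eq0 -raddfB /=.
have := cochain_ideal_coef0 (quot_repr (gen_ideal (@cochain_gens k n K)) g).
move=> /(_ s (J :\: s) sK); rewrite ffunE ffunE => -> //.
by apply/pred0P => i; rewrite /= inE; case: (i \in s).
Qed.

Fact xu_coef_zmod J s : zmod_morphism (xu_coef J s).
Proof.
move=> a b; have [[g ->] [h ->]] := (quot_piW a, quot_piW b).
by rewrite -raddfB !xu_coefE ffunE ffunE raddfB.
Qed.

HB.instance Definition _ J s :=
  GRing.isZmodMorphism.Build A k (xu_coef J s) (xu_coef_zmod J s).

Lemma xu_coefM s a b : s \in K -> xu_coef setT s (a * b) =
  \sum_J (xu_coef J (s :&: J) a * xu_coef (~: J) (s :\: J) b)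
    *~ ext_sign (J :\: s) (~: J :\: s).
Proof.
move=> sK; have [[g ->] [h ->]] := (quot_piW a, quot_piW b).
rewrite -rmorphM xu_coefE ext_coefM // pair_big /=.
rewrite (reindex_onto (fun J => (s :&: J, J :\: s)) (fun p => p.1 :|: p.2)) /=; last first.
  move=> [s1 t1] /= /andP[ss tt]; congr (_, _).
    rewrite setIUr (setIidPr ss) (_ : s :&: t1 = set0) ?setU0 //.
    by apply/eqP; rewrite setI_eq0 disjoint_sym disjoints_subset; move: tt; rewrite setTD.
  rewrite setDUl (_ : s1 :\: s = set0) ?set0U; last by apply/eqP; rewrite setD_eq0.
  by apply/setDidPl; rewrite disjoints_subset; move: tt; rewrite setTD.
apply: eq_big => [J|J _].
  rewrite subsetIl setTD setDE subsetIr /=; apply/eqP/setP => i; rewrite !inE.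
  by case: (i \in s); case: (i \in J).
have E1 : J :\: s :&: J = J :\: s.
  by apply/setP => i; rewrite !inE; case: (i \in s); case: (i \in J).
have E2 : [set: 'I_n] :\: s :\: (J :\: s) = ~: J :\: s.
  by apply/setP => i; rewrite !inE; case: (i \in s); case: (i \in J).
have E3 : s :\: s :&: J = s :\: J by rewrite setDIr setDv set0U.
have E4 : ~: J :\: (s :\: J) = ~: J :\: s.
  by apply/setP => i; rewrite !inE; case: (i \in s); case: (i \in J).
by rewrite !xu_coefE E1 E2 E3 E4.
Qed.

Lemma xu_coef_diff J s a : s \in K -> s \subset J -> xu_coef J s (diff A a) =
  \sum_(i in s) xu_coef J (s :\ i) a *~ ext_sign [set i] (J :\: s).
Proof.
move=> sK sJ; have [g ->] := quot_piW a.
rewrite [diff A _](quot_diffE (@cochain_gens_hom k n K) (@cochain_gens_diff k n K)).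
rewrite xu_coefE ffunE raddf_sum [RHS]big_mkcond; apply: eq_bigr => i _ /=.
rewrite raddfMz /= face_coef_varM //; case: ifP => si; last by rewrite mul0rz.
rewrite xu_coefE; congr (face_coef _ (g _) *~ _); apply/setP => j; rewrite !inE.
by have [->|] := eqVneq j i; rewrite ?(subsetP sJ i si).
Qed.

Lemma xu_coef0_pos p a : deg A p.+1 a -> xu_coef set0 set0 a = 0.
Proof.
move=> [g Dg ->]; rewrite xu_coefE set0D; have := Dg set0.
rewrite /shift_gr cards0 subn0; exact: face_coef_pos.
Qed.

End CochainCoefficients.

(** * Monomial cochains *)

Section Monomials.
Variables (k : fieldType) (n : nat) (K : simplicial_complex n).
Local Notation A := (cochain_algebra k K).
Implicit Types (s t J : {set 'I_n}) (a b : A).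

Definition face_mono s : face_ring k K := quot_pi _ 'X_[mset s].
Definition ext_mono s t : face_koszul k K :=
  [ffun J => if J == t then face_mono s else 0].
Definition mono s t : A := quot_pi _ (ext_mono s t).

Lemma mono_nonface s t : s \notin K -> mono s t = 0.
Proof.
move=> sK; have s0 : face_mono s = 0.
  rewrite -(raddf0 (quot_pi (sr_ideal k K))); apply/quot_piP; rewrite subr0 -prod_vars.
  by apply: gen_ideal_gen; exists s.
rewrite /mono (_ : ext_mono s t = 0) ?raddf0 //.
by apply/ffunP => J; rewrite !ffunE s0 if_same.
Qed.

Lemma mono_deg s t : deg A (#|s|.*2 + #|t|) (mono s t).
Proof.
exists (ext_mono s t) => // J; rewrite ffunE; case: eqP => [->|_]; last exact: shift_gr0.
rewrite /shift_gr leq_addl addnK; exists 'X_[mset s] => // m.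
by rewrite msuppX inE => /eqP ->; rewrite mdeg_mset.
Qed.

Lemma xu_coef_mono J s s' t : s \in K ->
  xu_coef J s (mono s' t) = ((s == s') && (J :\: s == t))%:R.
Proof.
move=> sK; rewrite /mono xu_coefE ffunE; case: ifP => _; last by rewrite raddf0 andbF.
by rewrite face_coefE sK mcoeffX (inj_eq (@mset_inj _)) eq_sym andbT.
Qed.

Lemma ext_mulrzE (f : face_koszul k K) (c : int) J : (f *~ c) J = f J *~ c.
Proof. exact: ffunMzE. Qed.

Lemma monoM s s' t t' : [disjoint s & s'] ->
  mono s t * mono s' t' = mono (s :|: s') (t :|: t') *~ ext_sign t t'.
Proof.
move=> dss; rewrite -rmorphM -raddfMz; congr (quot_pi _ _); apply/ffunP => L.
rewrite ext_mulrzE ext_mulE [ext_mono _ _ L]ffunE; case: eqP => [->|ne]; last first.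
  rewrite mul0rz big1 // => J JL; rewrite !ffunE.
  case: eqP => [EJ|]; last by rewrite mul0r mul0rz.
  case: eqP => [EL|]; last by rewrite mulr0 mul0rz.
  by case: ne; rewrite -EJ -EL setDE setUIr setUCr setIT (setUidPr JL).
rewrite (bigD1 t) ?subsetUl //= big1 ?addr0 => [|J /andP[_ /negPf neJ]]; last first.
  by rewrite ffunE neJ mul0r mul0rz.
have Ess : face_mono (s :|: s') = face_mono s * face_mono s'.
  by rewrite /face_mono msetU // mpolyXD rmorphM.
rewrite !ffunE eqxx Ess; have [dtt|ndt] := boolP [disjoint t & t'].
  by rewrite setDUl setDv set0U (setDidPl _) ?eqxx // disjoint_sym.
rewrite [in RHS]/ext_sign (negPf ndt) mulr0z.
case: eqP => [E|_]; last by rewrite mulr0 mul0rz.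
case/negP: ndt; rewrite -E disjoint_sym disjoints_subset.
by apply/subsetP => i; rewrite !inE => /andP[].
Qed.

Lemma mono_diff s t : [disjoint s & t] ->
  diff A (mono s t) =
  \sum_(i in t) mono (i |: s) (t :\ i) *~ ext_sign [set i] (t :\ i).
Proof.
move=> dst.
rewrite [diff A _](quot_diffE (@cochain_gens_hom k n K) (@cochain_gens_diff k n K)).
under [RHS]eq_bigr do rewrite -raddfMz.
rewrite -raddf_sum; congr (quot_pi _ _); apply/ffunP => L.
rewrite ffunE sum_ffunE [RHS]big_mkcond; apply: eq_bigr => i _ /=.
case: ifP => it; last first.
  rewrite ffunE; case: eqP => [Et|_]; last by rewrite mulr0 mul0rz.
  by rewrite -Et setU11 in it.
rewrite ext_mulrzE !ffunE; case: (L =P t :\ i) => [->|ne].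
  rewrite setD1K // eqxx; congr (_ *~ _); rewrite /face_mono msetU ?mpolyXD ?rmorphM.
    by rewrite mset1.
  by rewrite disjoints1; apply/negP => si; have /pred0P/(_ i) := dst; rewrite /= si it.
rewrite mul0rz; case: eqP => [Et|_]; last by rewrite mulr0 mul0rz.
have [iL|iL] := boolP (i \in L); first by rewrite ext_sign_mem // mulr0z.
by case: ne; rewrite -Et setU1K.
Qed.

End Monomials.

(** * Products of cocycles, one multidegree at a time *)

Section Leibniz.
Variables (k : fieldType) (n : nat) (K : simplicial_complex n).
Local Notation A := (cochain_algebra k K).
Implicit Types (s J rho : {set 'I_n}) (z w : A).

(** The coboundary operator on the part of multidegree [setT] of the cochain
    algebra of the full simplex, [P s] being the coefficient of x_s u_(~ s). *)
Definition cobd (P : {set 'I_n} -> k) rho : k :=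
  \sum_(i in rho) P (rho :\ i) *~ ext_sign [set i] (~: rho).

Lemma xu_coef_diffT s z : s \in K -> xu_coef setT s (diff A z) = cobd (fun s => xu_coef setT s z) s.
Proof. by move=> sK; rewrite xu_coef_diff // /cobd -setTD. Qed.

(** The contribution of the multidegrees J of z and ~ J of w to the coefficient of
    x_s u_(~ s) in z * w. *)
Definition product_part J z w s : k :=
  (xu_coef J (s :&: J) z * xu_coef (~: J) (s :\: J) w) *~ ext_sign (J :\: s) (~: J :\: s).

Lemma xu_coefM_parts s z w : s \in K -> xu_coef setT s (z * w) = \sum_J product_part J z w s.
Proof. exact: xu_coefM. Qed.

Lemma ext_sign_mulr1 (a b c e : int) : a * a = 1 -> e * e = 1 -> a * b = c * e -> b * e = c * a.
Proof.
move=> aa ee E; have -> : b = a * (a * b) by rewrite mulrA aa mul1r.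
by rewrite E -!mulrA ee mulr1 mulrC.
Qed.

(** The lifts of the parts of z and w of multidegrees J and ~ J to the full
    simplex are not cocycles, but their coboundaries live on non-faces; so the
    Leibniz rule makes the coboundary of their product vanish at rho. *)
Lemma cobd_product_part J z w rho : diff A z = 0 -> diff A w = 0 ->
  rho :&: J \in K -> rho :\: J \in K -> cobd (product_part J z w) rho = 0.
Proof.
move=> dz dw zK wK; pose M := J :\: rho; pose N := ~: J :\: rho.
have EMN : ~: rho = M :|: N.
  by apply/setP => i; rewrite !inE; case: (i \in rho); case: (i \in J).
have sqrC i : i \in rho -> ext_sign [set i] (M :|: N) * ext_sign [set i] (M :|: N) = 1.
  by move=> ir; rewrite ext_sign_sqr // -EMN inE ir.
have sqrM i : i \in rho -> ext_sign [set i] M * ext_sign [set i] M = 1.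
  by move=> ir; rewrite ext_sign_sqr // inE ir.
have sqrN i : i \in rho -> ext_sign [set i] N * ext_sign [set i] N = 1.
  by move=> ir; rewrite ext_sign_sqr // inE ir.
have sz : \sum_(i in rho :&: J) xu_coef J ((rho :&: J) :\ i) z *~ ext_sign [set i] M = 0.
  by have := xu_coef_diff z zK (subsetIr _ _); rewrite dz raddf0 setDIr setDv setU0.
have sw : \sum_(i in rho :\: J) xu_coef (~: J) ((rho :\: J) :\ i) w *~ ext_sign [set i] N = 0.
  have := xu_coef_diff w wK (_ : rho :\: J \subset ~: J).
  rewrite dw raddf0 setDE subsetIr -setDE => /(_ isT) /esym.
  rewrite (_ : ~: J :\: (rho :\: J) = N) //.
  by apply/setP => i; rewrite !inE; case: (i \in rho); case: (i \in J).
rewrite /cobd EMN (bigID (fun i => i \in J)) /=.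
rewrite [X in X + _](_ : _ = 0) ?add0r.
  rewrite (_ : \sum_(i in rho | i \notin J) _ =
    (\sum_(i in rho :\: J) xu_coef (~: J) ((rho :\: J) :\ i) w *~ ext_sign [set i] N)
      * xu_coef J (rho :&: J) z *~ ((-1) ^+ #|M| * ext_sign M N)); last first.
    rewrite mulr_suml mulrz_suml; apply: eq_big => [i|i /andP[ir iJ]].
      by rewrite inE andbC.
    rewrite /product_part.
    have -> : (rho :\ i) :&: J = rho :&: J.
      by apply/setP => j; rewrite !inE; have [->|] := eqVneq j i; rewrite ?ir ?(negPf iJ).
    have -> : (rho :\ i) :\: J = (rho :\: J) :\ i by rewrite !setDDl setUC.
    have -> : J :\: (rho :\ i) = M.
      by apply/setP => j; rewrite !inE; have [->|] := eqVneq j i; rewrite ?ir ?(negPf iJ).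
    have -> : ~: J :\: (rho :\ i) = i |: N.
      by apply/setP => j; rewrite !inE; have [->|] := eqVneq j i; rewrite ?ir ?(negPf iJ).
    rewrite [xu_coef J _ _ * _]mulrC -mulrzA mulrzAl -mulrzA; congr (_ *~ _).
    have E1 := ext_signA M [set i] N; have E2 := ext_signA [set i] M N.
    rewrite ext_signC1 [M :|: [set i]]setUC -mulrA E2 mulrA in E1.
    rewrite (ext_sign_mulr1 (sqrN _ ir) (sqrC _ ir) (esym E1)).
    by rewrite mulrC.
  by rewrite sw mul0r mul0rz.
rewrite (_ : \sum_(i in rho | i \in J) _ =
    (\sum_(i in rho :&: J) xu_coef J ((rho :&: J) :\ i) z *~ ext_sign [set i] M)
      * xu_coef (~: J) (rho :\: J) w *~ (ext_sign M N)).
  by rewrite sz mul0r mul0rz.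
rewrite mulr_suml mulrz_suml; apply: eq_big => [i|i /andP[ir iJ]]; first by rewrite inE.
rewrite /product_part.
have -> : (rho :\ i) :&: J = (rho :&: J) :\ i by rewrite setIDAC.
have -> : (rho :\ i) :\: J = rho :\: J.
  by apply/setP => j; rewrite !inE; have [->|] := eqVneq j i; rewrite ?ir ?iJ.
have -> : J :\: (rho :\ i) = i |: M.
  by apply/setP => j; rewrite !inE; have [->|] := eqVneq j i; rewrite ?ir ?iJ.
have -> : ~: J :\: (rho :\ i) = N.
  by apply/setP => j; rewrite !inE; have [->|] := eqVneq j i; rewrite ?ir ?iJ.
rewrite mulrzAl -!mulrzA; congr (_ *~ _).
rewrite (ext_sign_mulr1 (sqrM _ ir) (sqrC _ ir) (ext_signA _ _ _)).
by rewrite mulrC.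
Qed.

End Leibniz.

(** * Sets of vertices given by lists *)

Section VertexLists.

(** The vertices 1, ..., 8 are the elements 0, ..., 7 of the ordinal type; lists of
    numbers make membership and signs computable. *)
Definition vset (s : seq nat) : {set 'I_8} := [set i : 'I_8 | i.+1 \in s].
Definition vlist (s : seq nat) := uniq s && all (mem (iota 1 8)) s.
Definition vertex (j : nat) : 'I_8 := inord j.-1.

Lemma vertexK j : j \in iota 1 8 -> (vertex j).+1 = j.
Proof. by case: j => // j; rewrite mem_iota => /andP[_ lt]; rewrite /= inordK. Qed.

Implicit Types (s t : seq nat).

Lemma all_vertices (p : pred nat) : all p (iota 1 8) -> forall i : 'I_8, p i.+1.
Proof. by move=> /allP H i; apply: H; rewrite mem_iota; apply: (ltn_ord i). Qed.

Lemma vset_sub s (J : {set 'I_8}) : vlist s -> (vset s \subset J) = all (fun j => vertex j \in J) s.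
Proof.
case/andP=> _ /allP vs; apply/subsetP/allP => [H j js|H i].
  by apply: H; rewrite inE vertexK //; exact: vs.
by rewrite inE => /H; rewrite /vertex /= inord_val.
Qed.

Lemma eq_vset s t : all (fun j => (j \in s) == (j \in t)) (iota 1 8) -> vset s = vset t.
Proof. by move=> /all_vertices H; apply/setP => i; rewrite !inE; apply/eqP; exact: H. Qed.

Lemma vsetU s t : vset s :|: vset t = vset (s ++ t).
Proof. by apply/setP => i; rewrite !inE mem_cat. Qed.

Lemma disjoint_vset s t : all (fun j => ~~ ((j \in s) && (j \in t))) (iota 1 8) ->
  [disjoint vset s & vset t].
Proof.
move=> /all_vertices H; apply/pred0P => i; rewrite /= !inE; apply/negP; apply/negP; exact: H.
Qed.

Lemma vset_eqE s t :
  (vset s == vset t) = all (fun j => (j \in s) == (j \in t)) (iota 1 8).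
Proof.
apply/eqP/idP => [/setP E|]; last exact: eq_vset.
apply/allP => j jv; have := E (vertex j); rewrite !inE vertexK // => ->; exact: eqxx.
Qed.

Lemma big_vset (R : Type) (idx : R) (op : Monoid.com_law idx) s (F : 'I_8 -> R) :
  vlist s -> \big[op/idx]_(i in vset s) F i = \big[op/idx]_(j <- s) F (vertex j).
Proof.
case/andP=> us /allP vs; have uv : uniq (map vertex s).
  rewrite map_inj_in_uniq // => i j /vs iv /vs jv E.
  by rewrite -(vertexK iv) -(vertexK jv) E.
rewrite -(big_map vertex xpredT) /= big_uniq //=; apply: eq_bigl => i.
rewrite inE; apply/idP/mapP => [is_|[j js ->]]; last by rewrite vertexK //; exact: vs.
by exists i.+1 => //; rewrite /vertex inord_val.
Qed.

Lemma vset1 j : j \in iota 1 8 -> [set vertex j] = vset [:: j].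
Proof.
move=> jv; apply/setP => i; rewrite !inE; apply/eqP/eqP => [->|Ei]; first exact: vertexK.
by rewrite /vertex -Ei inord_val.
Qed.

Lemma vset_rem s j : vlist s -> j \in s -> vset s :\ vertex j = vset (rem j s).
Proof.
case/andP=> us /allP vs js; apply/setP => i; rewrite !inE mem_rem_uniq // inE.
by congr (~~ _ && _); apply/eqP/eqP => [->|Ei]; [exact/vertexK/vs|rewrite /vertex -Ei inord_val].
Qed.

Lemma card_vset s : vlist s -> #|vset s| = size s.
Proof. by move=> vs; rewrite -sum1_card big_vset // sum1_size. Qed.

Lemma ext_sign_vset s t : vlist s -> vlist t ->
  all (fun j => ~~ ((j \in s) && (j \in t))) (iota 1 8) ->
  ext_sign (vset s) (vset t) = (-1) ^+ (\sum_(j <- s) \sum_(m <- t) (m < j))%N.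
Proof.
move=> vs vt dst; rewrite /ext_sign disjoint_vset // /inversions big_vset //.
congr (_ ^+ _); rewrite !big_seq; apply: eq_bigr => j js; rewrite big_vset // !big_seq.
apply: eq_bigr => m mt; rewrite -ltnS !vertexK //.
  by case/andP: vs => _ /allP; apply.
by case/andP: vt => _ /allP; apply.
Qed.

Lemma vsetC s : ~: vset s = vset [seq m <- iota 1 8 | m \notin s].
Proof.
apply/setP => i; rewrite !inE mem_filter (_ : i.+1 \in iota 1 8) ?andbT //.
by apply: (all_vertices (p := mem (iota 1 8))); apply/allP.
Qed.

Lemma cobd_vset (k : fieldType) (P : {set 'I_8} -> k) s : vlist s ->
  cobd P (vset s) = \sum_(j <- s)
    (-1) ^+ (\sum_(m <- [seq m <- iota 1 8 | m \notin s]) (m < j))%N * P (vset (rem j s)).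
Proof.
move=> vs; rewrite /cobd big_vset // big_seq [RHS]big_seq; apply: eq_bigr => j js.
have jv : j \in iota 1 8 by case/andP: vs => _ /allP; apply.
rewrite vset_rem // vset1 // vsetC ext_sign_vset ?big_seq1.
- by rewrite -[LHS]mulrzl rmorph_sign.
- by rewrite /vlist /= andbT.
- by rewrite /vlist filter_uniq ?iota_uniq //; apply/allP => m; rewrite mem_filter => /andP[].
by apply/allP => m _; rewrite inE mem_filter; case: eqP => // ->; rewrite js.
Qed.

End VertexLists.

(** * The complex K as a 4-sphere with two open balls removed *)

Ltac expand_cobd := rewrite !cobd_vset // unlock /=.

Section FundamentalCycle.
Variable k : fieldType.
Implicit Types (P : {set 'I_8} -> k) (l : seq nat).

(** Evaluation on the 3-sphere that is the join of the boundary of 1345 with the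
    points 7 and 8. The signs absorb those of the basis x_s u_(~ s), which is why
    7 and 8 occur with equal signs. *)
Definition cycle_eval P : k :=
  P (vset [:: 1; 3; 5; 7]) + P (vset [:: 1; 4; 5; 7])
  + P (vset [:: 1; 3; 4; 7]) - P (vset [:: 3; 4; 5; 7])
  + P (vset [:: 1; 3; 5; 8]) + P (vset [:: 1; 4; 5; 8])
  + P (vset [:: 1; 3; 4; 8]) - P (vset [:: 3; 4; 5; 8]).

(* The facets of the sphere S^0(1,2) * S^0(7,8) * boundary of 3456 are [star1345],
   [star3567] and [other_facets]; only the last ones lie in K. *)
Definition star1345 : seq (seq nat) := [:: [:: 1; 3; 4; 5; 7]; [:: 1; 3; 4; 5; 8]].

Definition star3567 : seq (seq nat) := [:: [:: 1; 3; 5; 6; 7]; [:: 2; 3; 5; 6; 7]].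

Definition other_facets : seq (seq nat) :=
  [:: [:: 2; 3; 4; 5; 7]; [:: 2; 3; 4; 5; 8]; [:: 1; 3; 5; 6; 8]; [:: 2; 3; 5; 6; 8];
      [:: 1; 3; 4; 6; 7]; [:: 1; 3; 4; 6; 8]; [:: 2; 3; 4; 6; 7]; [:: 2; 3; 4; 6; 8];
      [:: 1; 4; 5; 6; 7]; [:: 1; 4; 5; 6; 8]; [:: 2; 4; 5; 6; 7]; [:: 2; 4; 5; 6; 8]].

Definition join78 : seq (seq nat) :=
  [:: [:: 3; 4; 5; 7; 8]; [:: 1; 4; 5; 7; 8]; [:: 1; 3; 5; 7; 8]; [:: 1; 3; 4; 7; 8]].

Definition join12 : seq (seq nat) :=
  [:: [:: 1; 2; 5; 6; 7]; [:: 1; 2; 3; 6; 7]; [:: 1; 2; 3; 5; 7]; [:: 1; 2; 3; 5; 6]].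

Definition cobd_zero P (L : seq (seq nat)) := forall l, l \in L -> cobd P (vset l) = 0.

(** The cycle is the boundary of the star of 1345 in the 4-sphere. *)
Lemma cycle_eval_star1345 P : cobd_zero P star1345 -> cycle_eval P = 0.
Proof.
move=> P0; transitivity (- \sum_(l <- star1345) cobd P (vset l)).
  by rewrite unlock /= /cycle_eval; expand_cobd; ring.
by rewrite big_seq big1 ?oppr0.
Qed.

(** The cycle is the suspension of the boundary of 1345 with apexes 7 and 8, so it
    bounds the join of this boundary with the edge 78. *)
Lemma cycle_eval_join78 P : cobd_zero P join78 -> cycle_eval P = 0.
Proof.
move=> P0; rewrite [LHS](_ : _ = cobd P (vset [:: 3; 4; 5; 7; 8])
    - cobd P (vset [:: 1; 4; 5; 7; 8]) - cobd P (vset [:: 1; 3; 5; 7; 8])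
    - cobd P (vset [:: 1; 3; 4; 7; 8])).
  by rewrite !P0 // !subr0.
by rewrite /cycle_eval; expand_cobd; ring.
Qed.

(** The facets of a 4-sphere sum to a cycle, so the boundary of the star of 1345 is
    also the boundary of the complement of this star. *)
Lemma cycle_eval_star3567 P : cobd_zero P (other_facets ++ star3567) -> cycle_eval P = 0.
Proof.
move=> P0; transitivity (\sum_(l <- other_facets ++ star3567) cobd P (vset l)).
  by rewrite unlock /= /cycle_eval; expand_cobd; ring.
by rewrite big_seq big1.
Qed.

(** Across [other_facets] the cycle is homologous to the boundary of the star of
    3567, which is the suspension of the boundary of 3567 with apexes 1 and 2. *)
Lemma cycle_eval_join12 P : cobd_zero P (other_facets ++ join12) -> cycle_eval P = 0.
Proof.
move=> P0; rewrite [LHS](_ : _ = \sum_(l <- other_facets) cobd P (vset l)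
    - cobd P (vset [:: 1; 2; 5; 6; 7]) + cobd P (vset [:: 1; 2; 3; 6; 7])
    + cobd P (vset [:: 1; 2; 3; 5; 7]) + cobd P (vset [:: 1; 2; 3; 5; 6])).
  rewrite !P0 // subr0 !addr0 big_seq big1 // => l lo.
  by apply: P0; rewrite mem_cat lo.
by rewrite /cycle_eval unlock /=; expand_cobd; ring.
Qed.

Lemma cycle_eval_cobd P : cycle_eval (cobd P) = 0.
Proof. by rewrite /cycle_eval; expand_cobd; ring. Qed.

End FundamentalCycle.

Definition nonfaces : seq (seq nat) :=
  [:: [:: 1; 2]; [:: 1; 3; 4; 5]; [:: 3; 4; 5; 6]; [:: 3; 5; 6; 7]; [:: 7; 8]].

(** [b] is the membership predicate of a set J of vertices; both the part of [l] in J
    and the part of [l] outside J are faces. *)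
Definition faces_split (b : nat -> bool) (l : seq nat) :=
  all (fun N => ~~ all (fun j => (j \in l) && b j) N
             && ~~ all (fun j => (j \in l) && ~~ b j) N) nonfaces.

(** The sets 12, 1345, 3567 and 78 cover all vertices and each meets the next one, so a
    set J that splits none of them is empty or everything. If J splits one of them,
    then every 4-simplex of the corresponding filling of the cycle meets J and its
    complement in faces. *)
Lemma nontrivial_split b :
  ~~ all b (iota 1 8) -> ~~ all (fun j => ~~ b j) (iota 1 8) ->
  [|| all (faces_split b) star1345, all (faces_split b) join78,
      all (faces_split b) (other_facets ++ star3567)
    | all (faces_split b) (other_facets ++ join12)].
Proof.
rewrite /faces_split /=.
case: (b 1); case: (b 2); case: (b 3); case: (b 4); case: (b 5); case: (b 6);
  case: (b 7); case: (b 8); by [].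
Qed.

(** * The Massey product *)

Lemma prod_var8 (k : fieldType) l : vlist l ->
  \prod_(j <- l) var8 k j = 'X_[mset (vset l)].
Proof. by move=> vl; rewrite -prod_vars big_vset. Qed.

(** A squarefree monomial lies in a monomial ideal if and only if a generator
    divides it. *)
Lemma simplices_of_ideal (k : fieldType) (K : simplicial_complex 8) :
  (let x := var8 k in forall f : {mpoly k[8]},
      sr_ideal k K f <->
      gen_ideal (fun g => g \in [:: x 1%N * x 2%N;
                                   x 1%N * x 3%N * x 4%N * x 5%N;
                                   x 3%N * x 4%N * x 5%N * x 6%N;
                                   x 3%N * x 5%N * x 6%N * x 7%N;
                                   x 7%N * x 8%N]) f) ->
  forall s, (s \in K) = all (fun N => ~~ (vset N \subset s)) nonfaces.
Proof.
move=> I_K s; cbv zeta in I_K; set gens := [:: _; _; _; _; _] in I_K.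
have Egens : gens = [seq 'X_[mset (vset N)] | N <- nonfaces].
  by rewrite /= -!prod_var8 // !big_cons !big_nil !mulr1 !mulrA.
apply/idP/idP => [sK|/allP noN].
  apply/allP => N Nn; apply/negP => Ns; have NK := subset_simplex sK Ns.
  have : sr_ideal k K 'X_[mset (vset N)].
    by apply/I_K; apply: gen_ideal_gen; rewrite Egens; apply/mapP; exists N.
  by move/(sr_ideal_mcoeff0 NK)/eqP; rewrite mcoeffX eqxx oner_eq0.
apply: contraT => sK; have : sr_ideal k K 'X_[mset s].
  by apply: gen_ideal_gen; exists s => //; rewrite prod_vars.
move/I_K/(gen_ideal_mcoeff0 (m0 := mset s)) => /(_ _)/eqP.
rewrite mcoeffX eqxx oner_eq0; apply=> g m; rewrite Egens => /mapP[N Nn ->].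
rewrite msuppX inE => /eqP ->; apply: contraNN (noN N Nn) => /mnm_lepP le.
by apply/subsetP => i iN; have := le i; rewrite !mnmE iN; case: (i \in s).
Qed.

Section Complex.
Variables (k : fieldType) (K : simplicial_complex 8).
Hypothesis K_mem : forall s, (s \in K) = all (fun N => ~~ (vset N \subset s)) nonfaces.
Local Notation A := (cochain_algebra k K).
Implicit Types (l : seq nat) (J : {set 'I_8}) (a b z w : A).

Lemma vset_simplex l :
  (vset l \in K) = all (fun N => ~~ all (fun j => j \in l) N) nonfaces.
Proof.
by rewrite K_mem /= !vset_sub //= !inE !vertexK.
Qed.

Lemma faces_splitP J l : faces_split (fun j => vertex j \in J) l ->
  vset l :&: J \in K /\ vset l :\: J \in K.
Proof.
by rewrite /faces_split !K_mem /= !vset_sub //= !inE !vertexK // !andbT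
   ![(_ \notin J) && _]andbC=>
   /and5P[/andP[-> ->] /andP[-> ->] /andP[-> ->] /andP[-> ->] /andP[-> ->]].
Qed.

Definition cycle_functional a : k := cycle_eval (fun s => xu_coef setT s a).

Fact cycle_functional_zmod : zmod_morphism cycle_functional.
Proof. by move=> a b; rewrite /cycle_functional /cycle_eval !raddfB /=; ring. Qed.

HB.instance Definition _ :=
  GRing.isZmodMorphism.Build A k cycle_functional cycle_functional_zmod.

(** The cycle has no boundary. *)
Lemma cycle_functional_diff b : cycle_functional (diff A b) = 0.
Proof.
rewrite -[RHS](cycle_eval_cobd (fun s => xu_coef setT s b)).
by rewrite /cycle_functional /cycle_eval !xu_coef_diffT // vset_simplex.
Qed.

Lemma cycle_eval_product_part J z w : J != set0 -> J != setT ->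
  diff A z = 0 -> diff A w = 0 -> cycle_eval (product_part J z w) = 0.
Proof.
move=> J0 JT dz dw; pose b j := vertex j \in J.
have P0 L : all (faces_split b) L -> cobd_zero (product_part J z w) L.
  move=> /allP HL l /HL /faces_splitP[zK wK]; exact: cobd_product_part.
have /nontrivial_split : ~~ all b (iota 1 8).
  apply: contraNN JT => /all_vertices H; apply/eqP/setP => i; rewrite inE.
  by have := H i; rewrite /b /vertex /= inord_val.
have nb : ~~ all (fun j => ~~ b j) (iota 1 8).
  apply: contraNN J0 => /all_vertices H; apply/eqP/setP => i; rewrite inE.
  by apply/negbTE; have := H i; rewrite /b /vertex /= inord_val.
move=> /(_ nb) /or4P[] /P0.
- exact: cycle_eval_star1345.
- exact: cycle_eval_join78.
- exact: cycle_eval_star3567.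
- exact: cycle_eval_join12.
Qed.

(** The parts where J is empty or everything vanish since one of the factors has no
    component of degree 0; the other parts come from joins in which the cycle
    bounds. *)
Lemma cycle_functionalM p q z w : deg A p.+1 z -> deg A q.+1 w ->
  diff A z = 0 -> diff A w = 0 -> cycle_functional (z * w) = 0.
Proof.
move=> Dz Dw dz dw.
have -> : cycle_functional (z * w) = \sum_J cycle_eval (product_part J z w).
  rewrite /cycle_functional /cycle_eval !xu_coefM_parts ?vset_simplex //.
  by rewrite -!sumrN -!big_split.
apply: big1 => J _; have [->|J0] := eqVneq J set0.
  have P0 s : product_part set0 z w s = 0.
    by rewrite /product_part setI0 (xu_coef0_pos Dz) mul0r mul0rz.
  by rewrite /cycle_eval !P0 !subr0 !addr0.
have [->|JT] := eqVneq J setT; last exact: cycle_eval_product_part.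
have P0 s : product_part setT z w s = 0.
  by rewrite /product_part setCT setDT (xu_coef0_pos Dw) mulr0 mul0rz.
by rewrite /cycle_eval !P0 !subr0 !addr0.
Qed.

Definition vmono l1 l2 : A := mono k K (vset l1) (vset l2).

Lemma vmono_deg l1 l2 : vlist l1 -> vlist l2 ->
  deg A ((size l1).*2 + size l2) (vmono l1 l2).
Proof. by move=> v1 v2; rewrite -!card_vset //; exact: mono_deg. Qed.

Lemma vmono_eq0 l1 l2 : has (fun N => all (mem l1) N) nonfaces -> vmono l1 l2 = 0.
Proof.
move=> H; apply: mono_nonface; rewrite vset_simplex -has_predC.
by apply: sub_has H => N /=; rewrite negbK.
Qed.

Lemma eq_vmono l1 l2 l1' l2' :
  all (fun j => (j \in l1) == (j \in l1')) (iota 1 8) ->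
  all (fun j => (j \in l2) == (j \in l2')) (iota 1 8) -> vmono l1 l2 = vmono l1' l2'.
Proof. by move=> E1 E2; rewrite /vmono (eq_vset E1) (eq_vset E2). Qed.

Lemma vmonoM l1 l2 l1' l2' : vlist l2 -> vlist l2' ->
  all (fun j => ~~ ((j \in l1) && (j \in l1'))) (iota 1 8) ->
  all (fun j => ~~ ((j \in l2) && (j \in l2'))) (iota 1 8) ->
  vmono l1 l2 * vmono l1' l2' =
  vmono (l1 ++ l1') (l2 ++ l2') *~ (-1) ^+ (\sum_(j <- l2) \sum_(m <- l2') (m < j))%N.
Proof.
by move=> v v' d1 d2; rewrite /vmono monoM ?disjoint_vset // !vsetU ext_sign_vset.
Qed.

Lemma vmono_diff l1 l2 : vlist l2 ->
  all (fun j => ~~ ((j \in l1) && (j \in l2))) (iota 1 8) ->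
  diff A (vmono l1 l2) = \sum_(j <- l2) vmono (j :: l1) (rem j l2)
    *~ (-1) ^+ (\sum_(m <- rem j l2) (m < j))%N.
Proof.
move=> v2 dst; rewrite mono_diff ?disjoint_vset // big_vset // big_seq [RHS]big_seq.
apply: eq_bigr => j jl; have /andP[u2 /allP s2] := v2.
rewrite vset_rem // (vset1 (s2 _ jl)) vsetU ext_sign_vset ?big_seq1 //.
- by rewrite /vlist /= andbT; exact: s2.
- by rewrite /vlist rem_uniq //; apply/allP => m /mem_rem; exact: s2.
- by apply/allP => m _; rewrite inE mem_rem_uniq // inE; case: eqP.
Qed.

Lemma cycle_functional_vmono : cycle_functional (vmono [:: 1; 3; 5; 7] [:: 2; 4; 6; 8]) = 1.
Proof.
rewrite /cycle_functional /cycle_eval /vmono !xu_coef_mono ?vset_simplex //.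
by rewrite setTD vsetC !vset_eqE /= !addr0 !subr0.
Qed.

Lemma massey_representative :
  let a1 := vmono [:: 1] [:: 2] in let a2 := vmono [:: 3; 4; 5] [:: 6] in
  let a3 := vmono [:: 7] [:: 8] in let y := vmono [:: 3; 5; 7] [:: 4; 6; 8] in
  [/\ [/\ diff A a1 = 0, diff A a2 = 0 & diff A a3 = 0],
      a1 * a2 = 0, diff A y = a2 * a3 & cycle_functional (a1 * y) = 1].
Proof.
split; first split.
- by rewrite vmono_diff // unlock /= vmono_eq0 // mul0rz addr0.
- by rewrite vmono_diff // unlock /= vmono_eq0 // mul0rz addr0.
- by rewrite vmono_diff // unlock /= vmono_eq0 // mul0rz addr0.
- by rewrite vmonoM // vmono_eq0 // mul0rz.
- rewrite vmonoM // vmono_diff // unlock /=.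
  rewrite [vmono [:: 6; 3; 5; 7] _]vmono_eq0 // [vmono [:: 8; 3; 5; 7] _]vmono_eq0 //.
  by rewrite !mul0rz !addr0; congr (_ *~ _); exact: eq_vmono.
by rewrite vmonoM // unlock /= mulr1z cycle_functional_vmono.
Qed.

End Complex.

Theorem mainTheorem8 (k : fieldType) (k_char0 : [pchar k] =i pred0)
    (K : simplicial_complex 8)
    (I_K : let x := var8 k in forall f : {mpoly k[8]},
      sr_ideal k K f <->
      gen_ideal (fun g => g \in [:: x 1%N * x 2%N;
                                   x 1%N * x 3%N * x 4%N * x 5%N;
                                   x 3%N * x 4%N * x 5%N * x 6%N;
                                   x 3%N * x 5%N * x 6%N * x 7%N;
                                   x 7%N * x 8%N]) f) :
  exists alpha beta gamma : cohomology (cochain_algebra k K),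
    [/\ [/\ coh 3 alpha, coh 7 beta & coh 3 gamma],
        alpha * beta = 0,
        beta * gamma = 0,
        forall omega, massey 3 7 3 alpha beta gamma omega -> coh 12 omega
      & ~ decomposable (massey 3 7 3 alpha beta gamma)].
Proof.
have K_mem := simplices_of_ideal I_K.
have [[da1 da2 da3] a12 dy phi1] := massey_representative k K_mem.
set a1 := vmono k K _ _ in da1 a12 phi1; set a2 := vmono k K _ _ in da2 a12 dy.
set a3 := vmono k K _ _ in da3 dy; set y := vmono k K _ _ in dy phi1.
have D1 : deg (cochain_algebra k K) 3 a1 := @vmono_deg k K [:: 1] [:: 2] isT isT.
have D2 : deg (cochain_algebra k K) 7 a2 := @vmono_deg k K [:: 3; 4; 5] [:: 6] isT isT.
have D3 : deg (cochain_algebra k K) 3 a3 := @vmono_deg k K [:: 7] [:: 8] isT isT.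
have Dy : deg (cochain_algebra k K) 9 y := @vmono_deg k K [:: 3; 5; 7] [:: 4; 6; 8] isT isT.
have [alpha R1] := represents_exists da1; have [beta R2] := represents_exists da2.
have [gamma R3] := represents_exists da3; exists alpha, beta, gamma; split.
- by split; [exists a1|exists a2|exists a3].
- by apply: (represents_eq0 (b := 0) (representsM R1 R2)); rewrite raddf0 a12.
- exact: represents_eq0 (representsM R2 R3) dy.
- move=> omega [b1 [b2 [b3 [x [z [[Db1 _] _ [Db3 _] [Dx _ Dz _] Rm]]]]]].
  exists (x * b3 - (-1) ^+ 3 * b1 * z) => //; apply: grB.
    exact: (grM (p := 9) (q := 3)).
  rewrite -mulrA; apply: (grM (p := 0) (q := 12)); first exact: deg_sign.
  exact: (grM (p := 3) (q := 9)).
have [omega Momega Rm] := massey_zero_product D1 D2 D3 R1 R2 R3 a12 Dy dy.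
apply: (indecomposable_by_functional (cycle_functional_diff K_mem)
  (cycle_functionalM K_mem) Momega Rm).
by rewrite -signr_odd mul1r [X in X != 0]phi1 oner_eq0.
Qed.
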